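(* Let Assumptions (H1), (H2), (H3) hold and consider the decisions $x_n^k$ and functions $\mathcal{Q}_t^k$ generated by SREDA, with $\lambda_{T,k}=0$ for all $k$ and $\lim_{k\to+\infty}\lambda_{t,k}=0$ for $t=1,\ldots,T-1$. Then: (i) almost surely, for every $t=2,\ldots,T+1$ and every $n\in\mathrm{Nodes}(t-1)$, $\lim_{k\to+\infty}\big(\mathcal{Q}_t(x_n^k)-\mathcal{Q}_t^k(x_n^k)\big)=0$; (ii) almost surely, both sequences $(\bar F_1^{k-1}(x_0,x_{n_1}^k,x_1^{P,k},\xi_1))_k$ and $(\underline{\mathfrak{Q}}_1^k(x_0,\xi_1))_k$ converge to the optimal value $\mathcal{Q}_1(x_0)$; moreover, if $(x_n^* )_{n\in\mathcal{N}}$ is any accumulation point of $((x_n^k)_{n\in\mathcal{N}})_{k\ge1}$ ($\mathcal{N}$ the set of nodes), and $x_t(\xi_1,\ldots,\xi_t):=x_m^*$ where $m$ is the stage-$t$ node whose history of realizations from $n_1$ to $m$ is $(\xi_1,\ldots,\xi_t)$, then $(x_1,\ldots,x_T)$ is an optimal solution of the multistage problem, i.e. for every $t$, every node $n$ of stage $t-1$ and every $m\in C(n)$, $x_m^*$ is an optimal solution of $\inf\{F_t(x_n^*,x_m,\xi_m):x_m\in X_t(x_n^*,\xi_m)\}$ (with $x_{n_0}^*=x_0$).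
   Context: Stages $t=1,\ldots,T$; $x_0\in\mathbb{R}^n$ given, $\mathcal{X}_0:=\{x_0\}$. Random data process $(\xi_t)$: $\xi_1$ deterministic; (H1): $(\xi_t)$ is interstage independent and for $t=2,\ldots,T$, $\xi_t$ is a random vector in $\mathbb{R}^K$ with discrete distribution and finite support $\Theta_t=\{\xi_{t,1},\ldots,\xi_{t,M}\}$. The components of $\xi_t$ include the entries of $(b_t,A_t,B_t)$. For each $t$: $\mathcal{X}_t\subset\mathbb{R}^n$, $f_t(x_{t-1},x_t,\xi_t)\in\mathbb{R}\cup\{+\infty\}$, vector function $g_t(x_{t-1},x_t,\xi_t)$, and $X_t(x_{t-1},\xi_t)=\{x_t\in\mathcal{X}_t: g_t(x_{t-1},x_t,\xi_t)\le0,\ A_tx_t+B_tx_{t-1}=b_t\}$. Dynamic programming: $\mathcal{Q}_{T+1}\equiv0$; $\mathfrak{Q}_t(x_{t-1},\xi_t)=\inf\{F_t(x_{t-1},x_t,\xi_t):=f_t(x_{t-1},x_t,\xi_t)+\mathcal{Q}_{t+1}(x_t): x_t\in X_t(x_{t-1},\xi_t)\}$; $\mathcal{Q}_t(x_{t-1})=\mathbb{E}[\mathfrak{Q}_t(x_{t-1},\xi_t)]$ for $t=2,\ldots,T$; $\mathcal{Q}_1(x_0)=\mathfrak{Q}_1(x_0,\xi_1)$ is the optimal value of the multistage problem. $\mathcal{X}^\varepsilon:=\mathcal{X}+\varepsilon\mathbb{B}_n$ ($\mathbb{B}_n$ closed unit ball). (H2), for $t=1,\ldots,T$: 1) $\mathcal{X}_t$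 nonempty convex compact; 2) for all $x_{t-1},x_t$, $f_t(x_{t-1},x_t,\cdot)$ is measurable and for each $j$, $f_t(\cdot,\cdot,\xi_{t,j})$ is proper convex lsc; 3) for each $j$, each component of $g_t(\cdot,\cdot,\xi_{t,j})$ is convex lsc; 4) there is $\varepsilon>0$ such that for each $j$, $\mathcal{X}_{t-1}^\varepsilon\times\mathcal{X}_t\subset\mathrm{dom}\,f_t(\cdot,\cdot,\xi_{t,j})$ and $X_t(x_{t-1},\xi_{t,j})\neq\emptyset$ for all $x_{t-1}\in\mathcal{X}_{t-1}^\varepsilon$; 5) if $t\ge2$, for each $j$ there is $(\bar y,\bar x)\in(\mathcal{X}_{t-1}\times\mathrm{ri}(\mathcal{X}_t))\cap\mathrm{ri}(\{g_t(\cdot,\cdot,\xi_{t,j})\le0\})$ with $\bar x\in X_t(\bar y,\xi_{t,j})$. Scenario tree: root $n_0$ (stage 0, decision $x_0$) with one child $n_1$ (stage 1, $\xi_{n_1}=\xi_1$); each node of stage $t-1$ ($2\le t\le T$) has $M$ children $m$, one per $\xi_{t,j}$, with realization $\xi_m=\xi_{t,j}$ (containing $A_m,B_m,b_m$) and probability $p_m=\mathbb{P}(\xi_t=\xi_{t,j})$. $\mathrm{Nodes}(t)$ = nodes of stage $t$, $C(n)$ = children of $n$. SREDA: initial $\mathcal{Q}_t^0\le\mathcal{Q}_t$ ($t=2,\ldots,T$; e.g. $\equiv-\infty$), $\mathcal{Q}_{T+1}^k\equiv0$ for all $k$; nonnegative $\lambda_{t,k}$ with $\lambda_{t,1}=\lambda_{T,k}=0$;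 arbitrary prox-centers $x_t^{P,k}\in\mathcal{X}_t$. Iteration $k\ge1$: Forward pass: $x_{n_0}^k=x_0$; for $t=1,\ldots,T$, every node $n$ of stage $t-1$ and every $m\in C(n)$, $x_m^k$ is an optimal solution of $\min\{\bar F_t^{k-1}(x_n^k,x_m,x_t^{P,k},\xi_m):x_m\in X_t(x_n^k,\xi_m)\}$, where $\bar F_t^{k-1}(x_n,x_m,x^P,\xi_m)=f_t(x_n,x_m,\xi_m)+\mathcal{Q}_{t+1}^{k-1}(x_m)+\lambda_{t,k}\|x_m-x^P\|^2$. Backward pass: select nodes $(n_1^k,\ldots,n_T^k)$ with $n_1^k=n_1$ and $n_t^k\in C(n_{t-1}^k)$, corresponding to a sample $(\xi_1^k,\ldots,\xi_T^k)$. For $t=T,\ldots,2$, with $n=n_{t-1}^k$: for each $m\in C(n)$ compute $\underline{\mathfrak{Q}}_t^k(x_n^k,\xi_m)=\inf\{f_t(x_n^k,x_m,\xi_m)+\mathcal{Q}_{t+1}^k(x_m):x_m\in X_t(x_n^k,\xi_m)\}$ and a subgradient $\pi_m^k\in\partial\underline{\mathfrak{Q}}_t^k(\cdot,\xi_m)(x_n^k)$; set $\theta_t^k=\sum_{m\in C(n)}p_m\underline{\mathfrak{Q}}_t^k(x_n^k,\xi_m)$, $\beta_t^k=\sum_{m\in C(n)}p_m\pi_m^k$, cut $\mathcal{C}_t^k(y)=\theta_t^k+\langle\beta_t^k,y-x_n^k\rangle$, and $\mathcal{Q}_t^k=\max\{\mathcal{Q}_t^{k-1},\mathcal{C}_t^k\}$.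 Also $\underline{\mathfrak{Q}}_1^k(x_0,\xi_1)=\inf\{f_1(x_0,x,\xi_1)+\mathcal{Q}_2^k(x):x\in X_1(x_0,\xi_1)\}$. (H3): for every $j=1,\ldots,M$, $t=2,\ldots,T$, $k\ge1$, $\mathbb{P}(\xi_t^k=\xi_{t,j})=\mathbb{P}(\xi_t=\xi_{t,j})>0$, and $\xi_t^k$ is independent of $\sigma(\xi_2^1,\ldots,\xi_T^1,\ldots,\xi_2^{k-1},\ldots,\xi_T^{k-1},\xi_2^k,\ldots,\xi_{t-1}^k)$. *)

(* Defs.v *)
From HB Require Import structures.
From mathcomp Require Import all_boot all_order all_algebra.
From mathcomp Require Import all_classical all_reals all_analysis.
From mathcomp Require Import measurable_realfun.
Set Implicit Arguments.
Unset Strict Implicit.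
Unset Printing Implicit Defensive.
Import Order.TTheory GRing.Theory Num.Theory.
Import numFieldTopology.Exports numFieldNormedType.Exports.
Local Open Scope classical_set_scope.
Local Open Scope ring_scope.

(* Data of the multistage problem.  Decisions live in R^n = 'cV[R]_n,        *)
(* realizations of the data process live in R^K = 'rV[R]_K.                  *)
(*   mT          : number of stages T                                       *)
(*   mxi1        : the deterministic xi_1                                   *)
(*   mxi t j     : xi_{t,j}, j-th element of the support Theta_t (t>=2)     *)
(*   mp t j      : P(xi_t = xi_{t,j})                                        *)
(*   mX t        : the set cal X_t (t >= 1)                                  *)
(*   mf t x y xi : f_t(x_{t-1} = x, x_t = y, xi)                             *)
Record msp (R : realType) (n K M : nat) := MSP {
  mT : nat;
  mx0 : 'cV[R]_n;
  mxi1 : 'rV[R]_K;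
  mxi : nat -> 'I_M -> 'rV[R]_K;
  mp : nat -> 'I_M -> R;
  mX : nat -> set 'cV[R]_n;
  mf : nat -> 'cV[R]_n -> 'cV[R]_n -> 'rV[R]_K -> \bar R;
  mng : nat -> nat;
  mg : forall t : nat, 'cV[R]_n -> 'cV[R]_n -> 'rV[R]_K -> 'cV[R]_(mng t);
  mnb : nat -> nat;
  mA : forall t : nat, 'rV[R]_K -> 'M[R]_(mnb t, n);
  mB : forall t : nat, 'rV[R]_K -> 'M[R]_(mnb t, n);
  mb : forall t : nat, 'rV[R]_K -> 'cV[R]_(mnb t) }.

Section Defs.
Variables (R : realType) (n K M : nat).
Local Notation vec := 'cV[R]_n.

Definition sqdist (x y : vec) : R := \sum_(i < n) (x i ord0 - y i ord0) ^+ 2.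
Definition edist (x y : vec) : R := Num.sqrt (sqdist x y).
Definition pdist (a b : vec * vec) : R :=
  Num.sqrt (sqdist a.1 b.1 + sqdist a.2 b.2).
Definition dotv (x y : vec) : R := \sum_(i < n) x i ord0 * y i ord0.

Definition enlarge (X : set vec) (e : R) : set vec :=
  [set x | exists2 y, X y & edist x y <= e].

Definition aff_hull (V : lmodType R) (S : set V) : set V :=
  [set v | exists N (z : 'I_N -> V) (l : 'I_N -> R),
     [/\ forall i, S (z i), \sum_(i < N) l i = 1 & v = \sum_(i < N) l i *: z i]].
Definition relint (V : lmodType R) (d : V -> V -> R) (S : set V) : set V :=
  [set v | S v /\ exists2 e, 0 < e &
     forall w, aff_hull S w -> d v w < e -> S w].

Definition econvex2 (h : vec * vec -> \bar R) : Prop :=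
  forall (a b : vec * vec) (l : R), 0 < l < 1 ->
    (h ((l *: a.1 + (1 - l) *: b.1)%R, (l *: a.2 + (1 - l) *: b.2)%R)
       <= l%:E * h a + (1 - l)%:E * h b)%E.
Definition eproper (h : vec * vec -> \bar R) : Prop :=
  (exists z, (h z < +oo)%E) /\ (forall z, (-oo < h z)%E).
Definition edom (h : vec * vec -> \bar R) : set (vec * vec) :=
  [set z | (h z < +oo)%E].

Definition borel_meas (h : 'rV[R]_K -> \bar R) : Prop :=
  forall B : set (\bar R), measurable B -> <<s open >> (h @^-1` B).

Definition subgrad (phi : vec -> \bar R) (x pi : vec) : Prop :=
  phi x \is a fin_num /\
  forall y, (phi x + (dotv pi (y - x))%:E <= phi y)%E.

Definition is_argmin (S : set vec) (phi : vec -> \bar R) (y : vec) : Prop :=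
  S y /\ forall z, S z -> (phi y <= phi z)%E.

Variable P : msp R n K M.

Definition Xs (t : nat) : set vec := if t == 0%N then [set mx0 P] else mX P t.

Definition feas (t : nat) (x : vec) (xi : 'rV[R]_K) : set vec :=
  [set y | [/\ mX P t y, forall i, mg P t x y xi i ord0 <= 0
            & mA P t xi *m y + mB P t xi *m x = mb P t xi]].

Definition Qinf (t : nat) (Qn : vec -> \bar R) (x : vec) (xi : 'rV[R]_K)
  : \bar R :=
  ereal_inf [set (mf P t x y xi + Qn y)%E | y in feas t x xi].

(* Qd d = cal Q_{T+1-d} *)
Fixpoint Qd (d : nat) : vec -> \bar R :=
  match d with
  | 0 => fun _ => 0%E
  | d'.+1 => fun x =>
      (\sum_(j < M) (mp P (mT P - d') j)%:E *
          Qinf (mT P - d') (Qd d') x (mxi P (mT P - d') j))%E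
  end.

(* cal Q_t for t = 2, ..., T+1 *)
Definition Qv (t : nat) : vec -> \bar R := Qd (mT P + 1 - t).
Definition Qfrak (t : nat) (x : vec) (xi : 'rV[R]_K) : \bar R :=
  Qinf t (Qv t.+1) x xi.
Definition optval : \bar R := Qfrak 1 (mx0 P) (mxi1 P).

Definition supp (t : nat) (xi : 'rV[R]_K) : Prop :=
  (t = 1%N /\ xi = mxi1 P) \/ ((2 <= t)%N /\ exists j, xi = mxi P t j).

Definition H1 : Prop :=
  forall t, (2 <= t <= mT P)%N ->
    [/\ injective (mxi P t), forall j, 0 < mp P t j
      & \sum_(j < M) mp P t j = 1].

Definition H2 : Prop :=
  forall t, (1 <= t <= mT P)%N ->
  [/\ mX P t !=set0 /\ convex_set (mX P t) /\ compact (mX P t),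
      (forall x y, borel_meas (mf P t x y)) /\
      (forall xi, supp t xi ->
         let h := fun z : vec * vec => mf P t z.1 z.2 xi in
         [/\ eproper h, econvex2 h & lower_semicontinuous h]),
      (forall xi, supp t xi -> forall i,
         let h := fun z : vec * vec => (mg P t z.1 z.2 xi i ord0)%:E in
         econvex2 h /\ lower_semicontinuous h),
      (exists2 e, 0 < e & forall xi, supp t xi ->
         (forall x y, enlarge (Xs t.-1) e x -> mX P t y ->
            edom (fun z : vec * vec => mf P t z.1 z.2 xi) (x, y)) /\
         (forall x, enlarge (Xs t.-1) e x -> feas t x xi !=set0))
    & ((2 <= t)%N -> forall xi, supp t xi ->
         exists yb xb,
           [/\ Xs t.-1 yb, relint edist (mX P t) xb,
               relint pdist
                 [set z : vec * vec | forall i, mg P t z.1 z.2 xi i ord0 <= 0]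
                 (yb, xb)
             & feas t yb xi xb])].

Definition Fbar (t : nat) (xi : 'rV[R]_K) (Qn : vec -> \bar R) (lam : R)
   (xp x y : vec) : \bar R :=
  (mf P t x y xi + Qn y + (lam * sqdist y xp)%:E)%E.

(* Nodes: a node of stage t >= 1 is the list of indices j_2,...,j_t of the
   realizations xi_{2,j_2}, ..., xi_{t,j_t} on its history (n_1 = [::]);
   the children of n are the rcons n j.  The root n_0 is treated apart
   (its decision is x_0). *)

(* node of stage t selected in the backward pass from the sampled indices *)
Definition snode (s : nat -> nat -> 'I_M) (k t : nat) : seq 'I_M :=
  [seq s k i | i <- iota 2 t.-1].

Section Algo.
Variables (d : measure_display) (Omega : measurableType d).
Variable smp : Omega -> nat -> nat -> 'I_M. (* xi_t^k = xi_{t, smp w k t} *)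

Definition hist (k t : nat) (w : Omega) : nat -> nat -> option 'I_M :=
  fun k' t' =>
    if ((1 <= k' < k)%N && (2 <= t' <= mT P)%N) || ((k' == k) && (2 <= t' < t)%N)
    then Some (smp w k' t') else None.

Definition H3 (Pr : probability Omega R) : Prop :=
  (forall k t j, measurable [set w | smp w k t = j]) /\
  forall k t j, (1 <= k)%N -> (2 <= t <= mT P)%N ->
    [/\ Pr [set w | smp w k t = j] = (mp P t j)%:E,
        0 < mp P t j
      & forall S : set (nat -> nat -> option 'I_M),
          Pr ([set w | smp w k t = j] `&` (hist k t @^-1` S))
          = ((mp P t j)%:E * Pr (hist k t @^-1` S))%E].

Definition agree (w w' : Omega) (k : nat) : Prop :=
  forall k' t, (1 <= k' <= k)%N -> (2 <= t <= mT P)%N -> smp w k' t = smp w' k' t.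

(* The quantities generated by SREDA along every sample path w:
     lam t k   : lambda_{t,k}
     Q0 t      : cal Q_t^0
     xP w k t  : prox-center x_t^{P,k}
     x w k m   : x_m^k (m a node of stage >= 1)
     pi w k t j: pi_m^k for the child m = rcons (n_{t-1}^k) j
     Qc w k t  : cal Q_t^k  (t = 2..T+1)
   The algorithm is non-anticipative: iteration-k choices depend only on the
   samples drawn so far. *)
Definition SREDA (lam : nat -> nat -> R) (Q0 : nat -> vec -> \bar R)
  (xP : Omega -> nat -> nat -> vec) (x : Omega -> nat -> seq 'I_M -> vec)
  (pi : Omega -> nat -> nat -> 'I_M -> vec)
  (Qc : Omega -> nat -> nat -> vec -> \bar R) : Prop :=
  [/\
      (forall t k, 0 <= lam t k) /\ (forall t, lam t 1%N = 0) /\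
      (forall k, lam (mT P) k = 0) /\
      (forall t, (2 <= t <= mT P)%N -> forall y, (Q0 t y <= Qv t y)%E),
      (forall w k t, (1 <= k)%N -> (1 <= t <= mT P)%N -> mX P t (xP w k t)) /\
      ((forall w w' k, (1 <= k)%N -> agree w w' k.-1 ->
          x w k = x w' k /\ xP w k = xP w' k) /\
      (forall w w' k, (1 <= k)%N -> agree w w' k -> pi w k = pi w' k)),
      (forall w t, (2 <= t <= mT P)%N -> Qc w 0%N t = Q0 t) /\
      (forall w k, Qc w k (mT P).+1 = (fun _ => 0%E)),
      (forall w k, (1 <= k)%N ->
        is_argmin (feas 1 (mx0 P) (mxi1 P))
          (Fbar 1 (mxi1 P) (Qc w k.-1 2%N) (lam 1%N k) (xP w k 1%N) (mx0 P))
          (x w k [::]) /\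
        forall t, (2 <= t <= mT P)%N -> forall (nd : seq 'I_M) (j : 'I_M),
          size nd = (t - 2)%N ->
          is_argmin (feas t (x w k nd) (mxi P t j))
            (Fbar t (mxi P t j) (Qc w k.-1 t.+1) (lam t k) (xP w k t) (x w k nd))
            (x w k (rcons nd j)))
    &
      (forall w k t, (1 <= k)%N -> (2 <= t <= mT P)%N ->
        let nd := snode (smp w) k t.-1 in
        let xn := x w k nd in
        let Ql := fun (j : 'I_M) (z : vec) => Qinf t (Qc w k t.+1) z (mxi P t j) in
        (forall j, subgrad (Ql j) xn (pi w k t j)) /\
        Qc w k t = fun y =>
          Order.max (Qc w k.-1 t y)
            ((\sum_(j < M) (mp P t j)%:E * Ql j xn)
             + (dotv (\sum_(j < M) mp P t j *: pi w k t j) (y - xn))%:E)%E)].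

Definition accpt (xs : nat -> seq 'I_M -> vec) (xst : seq 'I_M -> vec) : Prop :=
  forall e, 0 < e -> forall N, exists2 k, (N <= k)%N &
    forall nd : seq 'I_M, (size nd <= (mT P).-1)%N -> edist (xs k nd) (xst nd) < e.

Definition optimal_policy (xst : seq 'I_M -> vec) : Prop :=
  is_argmin (feas 1 (mx0 P) (mxi1 P))
    (fun y => mf P 1 (mx0 P) y (mxi1 P) + Qv 2 y)%E (xst [::]) /\
  forall t, (2 <= t <= mT P)%N -> forall (nd : seq 'I_M) (j : 'I_M),
    size nd = (t - 2)%N ->
    is_argmin (feas t (xst nd) (mxi P t j))
      (fun y => mf P t (xst nd) y (mxi P t j) + Qv t.+1 y)%E (xst (rcons nd j)).

End Algo.
End Defs.

(* Main.v *)
(* The node values are treated by backward induction on the stage.  Cuts are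
   valid minorants with bounded slopes, because each Q_t is finite on an
   enlargement of X_{t-1}; hence the monotone sequence Q_t^k has increments that
   vanish uniformly on X_{t-1}.  At the iterations where a node is selected in the
   backward pass, the new cut inherits at that node the gaps of its children, up to
   the vanishing prox penalty.  The event "the gap at node n before iteration k
   exceeds e" depends only on the samples of the iterations before k, whereas the
   selection of n at iteration k has a fixed positive probability given these; so
   almost surely, if the gap is large infinitely often, it is large at infinitely
   many iterations selecting n, a contradiction.  Optimality of accumulation
   points follows from lower semicontinuity of f_t and of Q_{t+1} and from upper
   semicontinuity of the convex value functions on X_{t-1}. *)

Require Import Defs.
From HB Require Import structures.
From mathcomp Require Import all_boot all_order all_algebra.
From mathcomp Require Import all_classical all_reals all_analysis.
From mathcomp Require Import ring lra.
Import Order.TTheory GRing.Theory Num.Theory.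
Import numFieldTopology.Exports numFieldNormedType.Exports.
Local Open Scope classical_set_scope.
Local Open Scope ring_scope.

Set Implicit Arguments.
Unset Strict Implicit.

(** * Borel-Cantelli argument for events followed by a random selection *)

Section Selection.
Context d (T : measurableType d) (R : realType) (Pr : probability T R).

(* [E m k `&` N k] is the event that the first success [A j `&` N j], [m <= j],
   happens at [k]; these are disjoint, so [Pr (E m k)] is summable in [k] and
   Borel-Cantelli applies without any independence. *)
Lemma ae_infinitely_often_selected (A N : nat -> set T) (q : R) : 0 < q ->
  let E m k := [set w | [/\ (m <= k)%N, A k w &
                 forall j, (m <= j < k)%N -> ~ (A j w /\ N j w)]] in
  (forall m k, measurable (E m k)) -> (forall k, measurable (N k)) ->
  (forall m k, Pr (E m k `&` N k) = (q%:E * Pr (E m k))%E) ->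
  {ae Pr, forall w, (forall m, exists2 k, (m <= k)%N & A k w) ->
     forall m, exists2 k, (m <= k)%N & A k w /\ N k w}.
Proof.
move=> q0 E mE mN EN.
have sumE m : (\sum_(k <oo) Pr (E m k) < +oo)%E.
  have tE : trivIset setT (fun k => E m k `&` N k).
    apply/trivIsetP => i j _ _; wlog ij : i j / (i < j)%N.
      move=> W ne; have [ij|ji|e] := ltngtP i j; first exact: W.
        by rewrite setIC; apply: W => //; rewrite eq_sym.
      by rewrite e eqxx in ne.
    move=> _; apply/seteqP; split => // w [] [[mi Ai _] Ni] [[mj Aj hj] Nj].
    by apply: (hj i) => //; rewrite mi ij.
  have mEN k : measurable (E m k `&` N k) by exact: measurableI.
  have : (\sum_(k <oo) Pr (E m k `&` N k) <= 1)%E.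
    rewrite -(@eq_eseriesl _ (fun k => k \in [set: nat]) xpredT); last by move=> k; rewrite in_setT.
    rewrite -(measure_bigcup Pr setT) //; apply: probability_le1.
    by apply: bigcup_measurable => k _; exact: mEN.
  (* The disjoint events [E m k]&[N k] have total mass at most 1, so the masses [Pr (E m k)] sum to
     at most [1 / q]. *)
  rewrite (eq_eseriesr (fun k _ => EN m k)) nneseriesZl; last by move=> k _.
  have : (0 <= \sum_(k <oo) Pr (E m k))%E by apply: nneseries_ge0.
  case: (\sum_(k <oo) Pr (E m k))%E => [r||] //= _; first by rewrite ltry.
  by rewrite gt0_muley ?lte_fin// leye_eq.
have : {ae Pr, forall w m, ~ lim_sup_set (E m) w}.
  apply: ae_foralln => m; exists (lim_sup_set (E m)); split.
  - by apply: bigcapT_measurable => k; apply: bigcup_measurable => *; exact: mE.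
  - exact: lim_sup_set_cvg0 (sumE m).
  - by move=> w /=; rewrite notK.
apply: filterS => w noE Aio m.
(* If no success occurs from [m] on, each later occurrence of [A] at [l] satisfies the first-success
   condition, so [w] lies in [E m l] for infinitely many [l]. *)
apply: contrapT => H; apply: (noE m) => k _.
have [l kl Al] := Aio (maxn m k); rewrite geq_max in kl; case/andP: kl => ml kl.
exists l; rewrite //=; split => // j /andP[mj jl] AN; apply: H; exists j => //.
Qed.

End Selection.

(** * Events determined by the sampling history *)

Section History.
Context (R : realType) (n K M : nat) (P : msp R n K M).
Context d (Omega : measurableType d) (Pr : probability Omega R).
Variable smp : Omega -> nat -> nat -> 'I_M.

(** Dependence on [f] alone is expressed as saturation under the fibres of [f]; no sigma-algebra is
    involved, and measurability is recovered because only finitely many samples matter. *)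
Definition determined_by (I : Type) (f : Omega -> I) (E : set Omega) :=
  forall w w', f w = f w' -> E w -> E w'.

Lemma measurable_finitely_determined (L : seq (nat * nat)) (E : set Omega) :
  (forall k t j, measurable [set w | smp w k t = j]) ->
  (forall w w', (forall c, c \in L -> smp w c.1 c.2 = smp w' c.1 c.2) ->
     E w -> E w') ->
  measurable E.
Proof.
move=> mS; elim: L E => [|c L IH] E EL.
  have [[w Ew]|/set0P/negP] := pselect (E !=set0); last first.
    by rewrite negbK => /eqP ->; exact: measurable0.
  rewrite (_ : E = setT); first exact: measurableT.
  by apply/seteqP; split => // w' _; apply: (EL w).
(* [F j] is the slice of [E] at value [j] with the coordinate [c] forgotten, so that it depends on
   [L] only. *)
pose F j := [set w | exists w', [/\ E w', smp w' c.1 c.2 = j &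
  forall e, e \in L -> smp w e.1 e.2 = smp w' e.1 e.2]].
rewrite (_ : E = \bigcup_(j in [set: 'I_M])
     (F j `&` [set w | smp w c.1 c.2 = j])).
  apply: fin_bigcup_measurable; first exact: finite_finset.
  move=> j _; apply: measurableI; last exact: mS.
  apply: IH => w w' ww' [v [Ev vj Lv]]; exists v; split => // e eL.
  by rewrite -ww' // Lv.
apply/seteqP; split => [w Ew|w [j _ [[w' [Ew' w'j Lw]] /= wj]]].
  by exists (smp w c.1 c.2) => //; split => //; exists w.
apply: (EL w') Ew' => e; rewrite inE => /orP[/eqP ->|eL]; first by rewrite w'j.
by rewrite -Lw.
Qed.

Lemma measurable_hist_determined k t E :
  (forall k t j, measurable [set w | smp w k t = j]) -> (t <= (mT P).+1)%N ->
  determined_by (hist P smp k t) E -> measurable E.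
Proof.
move=> mS tT dE.
apply: (@measurable_finitely_determined
  [seq (k', t') | k' <- iota 0 k.+1, t' <- iota 0 (mT P).+1]) => // w w' ww'.
apply: dE; apply/funext => k'; apply/funext => t'; rewrite /hist.
case: ifP => // H; congr Some; apply: (ww' (k', t')); apply: allpairs_f.
  rewrite mem_iota add0n ltnS /=.
  by case/orP: H => [/andP[/andP[_ /ltnW] //]|/andP[/eqP -> _]].
rewrite mem_iota add0n ltnS /=.
case/orP: H => [/andP[_ /andP[_ //]]|/andP[_ /andP[_ t't]]].
by rewrite -ltnS (leq_trans t't).
Qed.

(** Chain rule along the path to [nd]: each application of (H3) splits off the last sampled index,
    so [q] is the product of the [mp] along the path, the same for every [k] and [E]. *)
Lemma probability_select (nd : seq 'I_M) : H3 P smp Pr ->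
  ((size nd).+1 <= mT P)%N ->
  exists2 q : R, 0 < q & forall k E, (1 <= k)%N ->
    determined_by (hist P smp k 2) E ->
    Pr (E `&` [set w | snode (smp w) k (size nd).+1 = nd]) = (q%:E * Pr E)%E.
Proof.
move=> [mS h3]; elim/last_ind: nd => [|nd j IH] ndT.
  exists 1 => // k E k1 _; rewrite mul1e; congr (Pr _).
  by apply/seteqP; split => [w []|w] //.
rewrite size_rcons in ndT *; have [|q q0 IHq] := IH; first exact: ltnW.
exists (mp P (size nd).+2 j * q).
  by have [||_ p0 _] := h3 1%N (size nd).+2 j => //; exact: mulr_gt0.
move=> k E k1 dE; have [||_ _] := h3 k (size nd).+2 j => //.
set F := E `&` [set w | snode (smp w) k (size nd).+1 = nd].
have dF : determined_by (hist P smp k (size nd).+2) F.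
  have sub w w' : hist P smp k (size nd).+2 w = hist P smp k (size nd).+2 w' ->
      hist P smp k 2 w = hist P smp k 2 w'.
    move=> e; apply/funext => k'; apply/funext => t'.
    have := congr1 (fun h => h k' t') e; rewrite /hist.
    case: (_ && (2 <= t' <= mT P)%N) => //= _.
    have -> : (2 <= t' < 2)%N = false by case: (t') => [|[|[|?]]].
    by rewrite andbF.
  move=> w w' e [Ew Nw]; split; first exact: dE (sub _ _ e) Ew.
  rewrite /= -[RHS]Nw /snode /=; apply/eq_in_map => i; rewrite mem_iota => hi.
  have := congr1 (fun h => h k i) e; rewrite /hist eqxx /=.
  have -> : (2 <= i < (size nd).+2)%N by exact: hi.
  by rewrite orbT => -[].
(* (H3) speaks of preimages under [hist]; since [F] is saturated, it is the preimage of its own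
   image. *)
move=> /(_ [set hist P smp k (size nd).+2 w | w in F]).
have -> : hist P smp k (size nd).+2 @^-1` [set hist P smp k (size nd).+2 w | w in F] = F.
  by apply/seteqP; split => w /= => [[w' Fw' e]|Fw]; [exact: dF e Fw'|exists w].
rewrite IHq // muleA -EFinM => <-; congr (Pr _).
have sr w : snode (smp w) k (size nd).+2 =
    rcons (snode (smp w) k (size nd).+1) (smp w k (size nd).+2).
  have iS : iota 2 (size nd).+1 = rcons (iota 2 (size nd)) (size nd).+2.
    by have := iotaD 2 (size nd) 1; rewrite cats1 add2n addn1.
  exact: etrans (congr1 (map _) iS) (map_rcons _ _ _).
apply/seteqP; split => w /=.
  by move=> [Ew]; rewrite sr => /rcons_inj[h1 h2]; split => //; split.
by move=> [wj [Ew h]]; split => //; rewrite sr h wj.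
Qed.

Lemma ae_infinitely_often_selected_node (Bad : nat -> set Omega)
    (nd : seq 'I_M) :
  H3 P smp Pr -> ((size nd).+1 <= mT P)%N ->
  (forall k, (1 <= k)%N -> determined_by (hist P smp k 2) (Bad k)) ->
  {ae Pr, forall w, (forall m, exists2 k, (m <= k)%N & Bad k w) ->
     forall m, exists2 k, (m <= k)%N &
       Bad k w /\ snode (smp w) k (size nd).+1 = nd}.
Proof.
move=> h3 ndT dB; have [q q0 qP] := probability_select h3 ndT.
(* Iteration 0 draws no sample governed by (H3), so it is excluded from the events. *)
pose A k := [set w | (1 <= k)%N /\ Bad k w].
pose N k := [set w | snode (smp w) k (size nd).+1 = nd].
have mS := h3.1.
have mN k : measurable (N k).
  apply: (@measurable_hist_determined k (mT P).+1) => // w w' e.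
  rewrite /N /= => Nw; rewrite -[RHS]Nw /snode; apply/eq_in_map => i.
  rewrite mem_iota add2n /= ltnS => /andP[i2 iT].
  have := congr1 (fun h => h k i) e; rewrite /hist eqxx /= i2 ltnS.
  by rewrite (leq_trans iT ndT) orbT => -[].
have hist_mono w w' j k : (1 <= j < k)%N ->
    hist P smp k 2 w = hist P smp k 2 w' ->
    hist P smp j 2 w = hist P smp j 2 w' /\
    forall i, (2 <= i <= mT P)%N -> smp w j i = smp w' j i.
  move=> /andP[j1 jk] e; split; last first.
    move=> i iT; have := congr1 (fun h => h j i) e.
    by rewrite /hist j1 jk iT /= => -[].
  apply/funext => k'; apply/funext => t'; rewrite /hist.
  have -> : (2 <= t' < 2)%N = false by case: t' => [|[|[|?]]].
  rewrite andbF orbF; case: ifP => // /andP[/andP[k1 kj] tT].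
  have := congr1 (fun h => h k' t') e.
  by rewrite /hist k1 (ltn_trans kj jk) tT.
(* The first-success event mentions selections only at iterations [j < k], so it too depends on the
   samples before [k] and selection at [k] is independent of it. *)
have dE m k : (1 <= k)%N -> determined_by (hist P smp k 2)
   [set w | [/\ (m <= k)%N, A k w &
                 forall j, (m <= j < k)%N -> ~ (A j w /\ N j w)]].
  move=> k1 w w' e [mk [_ Bk] H]; split => //.
    by split => //; exact: dB e Bk.
  move=> j /[dup] jk /andP[_ jltk] [[j1 Bj] Nj]; apply: (H j jk).
  have [||e1 e2] := hist_mono w w' j k => //; first by rewrite j1.
  split; first by split => //; exact: dB (esym e1) Bj.
  rewrite /N /= -[RHS]Nj /snode; apply/eq_in_map => i.
  rewrite mem_iota add2n /= ltnS => /andP[i2 iT].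
  by apply: e2; rewrite i2 (leq_trans iT ndT).
have E0 m : [set w | [/\ (m <= 0)%N, A 0%N w &
                 forall j, (m <= j < 0)%N -> ~ (A j w /\ N j w)]] = set0.
  by apply/seteqP; split => // w [_ []].
have := @ae_infinitely_often_selected _ _ _ Pr A N q q0.
case=> //.
- move=> m [|k]; first by rewrite E0; exact: measurable0.
  apply: (measurable_hist_determined mS _ (dE m k.+1 isT)).
  exact: leq_ltn_trans (leq0n _) ndT.
- move=> m [|k]; first by rewrite E0 set0I measure0 mule0.
  by rewrite qP //; exact: dE.
move=> B [mB B0 sB]; exists B; split => // w /= H; apply: sB => /= H'; apply: H.
move=> io m; have [|k mk [[_ Bk] Nk]] := H' _ m; last by exists k.
move=> m'; have [k] := io m'.+1; rewrite /A /= => mk Bk; exists k.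
  exact: ltnW.
by split => //; exact: leq_ltn_trans mk.
Qed.

End History.

(** * Local bounds, continuity and uniform convergence for convex functions *)

Section Convex.
Context (R : realType).

(* Convexity of the strict epigraph: meaningful whatever infinite values [phi]
   takes, and stable under infima because [inf < u] provides a witness. *)
Definition strictly_below_convex (V : lmodType R) (phi : V -> \bar R) :=
  forall a b (u v l : R), 0 < l < 1 -> (phi a < u%:E)%E -> (phi b < v%:E)%E ->
    (phi (l *: a + (1 - l) *: b)%R < (l * u + (1 - l) * v)%:E)%E.

Lemma lte_real_above (e : \bar R) : (e < +oo)%E -> exists u : R, (e < u%:E)%E.
Proof.
case: e => [r||] // _; last by exists 0; rewrite ltNyr.
by exists (r + 1); rewrite lte_fin ltrDl.
Qed.

Lemma convex_sublevel (V : lmodType R) (phi : V -> \bar R) (u l : R) a b :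
  strictly_below_convex phi -> 0 <= l <= 1 ->
  (phi a < u%:E)%E -> (phi b < u%:E)%E ->
  (phi (l *: a + (1 - l) *: b)%R < u%:E)%E.
Proof.
move=> cphi /andP[]; rewrite le_eqVlt => /orP[/eqP <- _ _|l0].
  by rewrite scale0r add0r subr0 scale1r.
rewrite le_eqVlt => /orP[/eqP -> pa _|l1 pa pb].
  by rewrite subrr scale0r addr0 scale1r.
have := cphi a b u u l; rewrite l0 l1 => /(_ isT pa pb).
by rewrite (_ : l * u + _ = u) //; lra.
Qed.

Lemma convex_sublevel_mean (V : lmodType R) (phi : V -> \bar R) (u : R)
    (s : seq V) :
  strictly_below_convex phi -> (0 < size s)%N ->
  (forall v, v \in s -> (phi v < u%:E)%E) ->
  (phi ((size s)%:R^-1 *: \sum_(v <- s) v)%R < u%:E)%E.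
Proof.
move=> cphi; elim: s => // a [|b s] IH _ sP.
  by rewrite big_seq1 /= invr1 scale1r sP // mem_head.
have {}IH := IH isT (fun v vs => sP v (@mem_behead _ [:: a, b & s] v vs)).
rewrite big_cons; move: (\sum_(v <- _) v) IH => S IH.
set m := size (b :: s) in IH *; have m0 : (0 < m%:R :> R) by rewrite ltr0n.
rewrite (_ : _ *: _ = (m.+1%:R^-1) *: a + (1 - m.+1%:R^-1) *: (m%:R^-1 *: S)).
  apply: convex_sublevel => //; last by apply: sP; exact: mem_head.
  by rewrite invr_ge0 ler0n invf_le1 ?ltr0n // ler1n.
rewrite scalerDr scalerA; congr (_ + _ *: _).
have m1 : (0 < m.+1%:R :> R) by rewrite ltr0n.
apply: (mulfI (lt0r_neq0 m1)); rewrite mulfV ?lt0r_neq0 // mulrA mulrBr mulr1.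
rewrite mulfV ?lt0r_neq0 // -natr1 addrK mulfV // lt0r_neq0 //.
Qed.

Lemma mx_norm_le (m n : nat) (A : 'M[R]_(m, n)) (r : R) :
  0 <= r -> (forall i j, `|A i j| <= r) -> `|A| <= r.
Proof.
move=> r0 Ar; rewrite [`|A|]mx_normrE.
by apply: bigmax_le => // -[i j] _; exact: Ar.
Qed.

Lemma le_mx_norm (m n : nat) (A : 'M[R]_(m, n)) i j : `|A i j| <= `|A|.
Proof.
rewrite [`|A|]mx_normrE.
exact: (le_bigmax_cond _ (fun ij : 'I_m * 'I_n => `|A ij.1 ij.2|) (isT : xpredT (i, j))).
Qed.

(** Finitely many points suffice: a bound at the [2n] points [x +- e e_i] passes to the axis
    segments between them, and a nearby [y] is the average of the [n] axis points
    [x + n (y - x)_i e_i]. Dimension 0 is trivial. *)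
Lemma convex_locally_bounded (n : nat) (phi : 'cV[R]_n -> \bar R) x e :
  strictly_below_convex phi -> 0 < e ->
  (forall y, `|y - x| <= e -> (phi y < +oo)%E) ->
  exists r u, 0 < r /\ forall y, `|y - x| <= r -> (phi y < u%:E)%E.
Proof.
case: n phi x => [|n] phi x cphi e0 fin.
  have [|u xu] := @lte_real_above (phi x).
    by apply: fin; rewrite subrr normr0 ltW.
  by exists 1, u; split => // y _; rewrite (_ : y = x) // flatmx0 [RHS]flatmx0.
have nd (s : R) (i : 'I_n.+1) : `|s *: (delta_mx i ord0 : 'cV[R]_n.+1)| <= `|s|.
  apply: mx_norm_le => // k l; rewrite !mxE; case: (_ && _) => /=.
    by rewrite mulr1.
  by rewrite mulr0 normr0.
have bnd (z : 'I_n.+1 * bool) : exists u : R,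
    (phi (x + ((-1) ^+ z.2 * e) *: delta_mx z.1 ord0)%R < u%:E)%E.
  apply/lte_real_above/fin; rewrite addrAC subrr add0r (le_trans (nd _ _)) //.
  by rewrite normrM normrX normrN1 expr1n mul1r gtr0_norm.
have [u uP] := choice bnd.
pose U := \sum_z `|u z|.
have uU z : u z <= U.
  rewrite (le_trans (ler_norm _)) // /U (bigD1 z) //= lerDl; exact: sumr_ge0.
have axis i s : `|s| <= e -> (phi (x + s *: delta_mx i ord0)%R < U%:E)%E.
  (* [l] below is the barycentric coordinate of [s] in the segment from [-e] to [e]. *)
  rewrite ler_norml => /andP[s1 s2].
  have e2 : 0 < e + e by rewrite addr_gt0.
  pose l := (s + e) / (e + e).
  have lE : l * (e + e) = s + e by rewrite divfK // lt0r_neq0.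
  rewrite (_ : x + _ = l *: (x + ((-1) ^+ false * e) *: delta_mx i ord0) +
     (1 - l) *: (x + ((-1) ^+ true * e) *: delta_mx i ord0)).
    apply: convex_sublevel => //.
    - by rewrite /l ler_pdivrMr // ler_pdivlMr // mul0r mul1r; lra.
    - by apply: (lt_le_trans (uP (i, false))); rewrite lee_fin.
    - by apply: (lt_le_trans (uP (i, true))); rewrite lee_fin.
  apply/matrixP => k j; rewrite !mxE expr0 expr1.
  set D := (_%:R : R); transitivity (x k j + (l * (e + e) - e) * D).
    by rewrite lE addrK.
  lra.
exists (e / n.+1%:R), U; split; first by rewrite divr_gt0 // ltr0n.
move=> y yx.
pose s := [seq x + (n.+1%:R * (y - x) i ord0) *: delta_mx i ord0 | i <- enum 'I_n.+1].
have ss : size s = n.+1 by rewrite size_map size_enum_ord.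
have n0 : (n.+1%:R != 0 :> R) by rewrite pnatr_eq0.
rewrite (_ : y = (size s)%:R^-1 *: \sum_(v <- s) v).
  apply: convex_sublevel_mean; rewrite ?ss // => v /mapP[i _ ->].
  apply: axis; rewrite normrM normr_nat mulrC -ler_pdivlMr ?ltr0n //.
  exact: le_trans (le_mx_norm _ _ _) yx.
rewrite ss big_map big_enum /= big_split /= sumr_const card_ord.
rewrite scalerDr -[x *+ _]scaler_nat scalerA mulVf // scale1r.
rewrite (eq_bigr (fun i => n.+1%:R *: ((y - x) i ord0 *: delta_mx i ord0))).
  rewrite -scaler_sumr scalerA mulVf // scale1r.
  rewrite (_ : \sum_(i < n.+1) _ = y - x) ?subrKC // [RHS]matrix_sum_delta.
  by apply: eq_bigr => i _; rewrite big_ord1.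
by move=> i _; rewrite scalerA.
Qed.

(** The upper estimate puts [y] between [x] and [x + (y - x) / s]; the lower one puts [x] between
    [y] and [x - (y - x) / s]. Both outer points stay in the ball where [u] is a bound. *)
Lemma convex_continuous (V : normedModType R) (phi : V -> \bar R) (x : V)
    (v r u : R) :
  strictly_below_convex phi -> phi x = v%:E -> 0 < r ->
  (forall y, `|y - x| <= r -> (phi y < u%:E)%E) ->
  forall e, 0 < e -> exists2 h, 0 < h & forall y, `|y - x| < h ->
    ((v - e)%:E < phi y)%E /\ (phi y < (v + e)%:E)%E.
Proof.
move=> cphi xv r0 bnd e e0.
have vu : v < u by rewrite -lte_fin -xv bnd // subrr normr0 ltW.
(* Chosen so that [s < 1] and [s * (u - v) < e / 2]: moving a fraction [s] towards a point below [u]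
   costs less than [e / 2]. *)
pose s := e / (2 * (u - v) + 2 * e).
have den : 0 < 2 * (u - v) + 2 * e by lra.
have s0 : 0 < s by rewrite divr_gt0.
have sE : s * (2 * (u - v) + 2 * e) = e by rewrite divfK // lt0r_neq0.
have s1 : s < 1 by rewrite ltr_pdivrMr //; lra.
have suv : s * (u - v) < e / 2.
  have : 0 < s * e by rewrite mulr_gt0.
  by move: sE; nra.
exists (s * r) => [|y yx]; first exact: mulr_gt0.
have zx (z : V) : `|z| < s * r -> `|s^-1 *: z| <= r.
  by move=> zr; rewrite normrZ gtr0_norm ?invr_gt0 // ler_pdivrMl // ltW.
split; last first.
  have := cphi (x + s^-1 *: (y - x)) x u (v + e / 2) s.
  rewrite s0 s1 => /(_ isT); rewrite xv lte_fin => H.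
  have {}H := H (bnd _ _) _; rewrite addrAC subrr add0r in H.
  have {}H := H (zx _ yx) ltac:(lra).
  move: H; rewrite scalerDr scalerA mulfV ?lt0r_neq0 // scale1r addrAC -scalerDl.
  rewrite subrKC scale1r subrKC => /lt_le_trans; apply.
  by rewrite lee_fin; move: suv; nra.
rewrite ltNge; apply/negP => yv.
(* The weight for which [l y + (1 - l) (x - (y - x) / s) = x], since [1 - l = l s]. *)
pose l := (1 + s)^-1.
have p1 : 0 < 1 + s by lra.
have lE : l * (1 + s) = 1 by rewrite mulVf // lt0r_neq0.
have l0 : 0 < l by rewrite invr_gt0.
have l1 : l < 1 by rewrite invf_lt1 //; lra.
have := cphi y (x - s^-1 *: (y - x)) (v - e / 2) u l.
rewrite l0 l1 => /(_ isT) H.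
have {}H := H (le_lt_trans yv _) (bnd _ _).
rewrite lte_fin addrAC subrr add0r normrN in H.
have {}H := H ltac:(lra) (zx _ yx).
move: H; rewrite (_ : l *: y + _ = x).
  rewrite xv lte_fin => H.
  have : (1 + s) * v < (1 + s) * (l * (v - e / 2) + (1 - l) * u) by rewrite ltr_pM2l.
  have -> : (1 + s) * (l * (v - e / 2) + (1 - l) * u) =
     (l * (1 + s)) * (v - e / 2 - u) + (1 + s) * u by lra.
  by rewrite lE; move: suv; nra.
have l1s : 1 - l = l * s by rewrite -lE; lra.
have lss : l * s * s^-1 = l by rewrite mulfK // lt0r_neq0.
rewrite l1s (scalerBr (l * s)) (scalerA (l * s)) lss scalerBr opprB.
rewrite addrCA [l *: y + _]addrC subrK -scalerDl addrC.
by rewrite -[X in X + _]mulr1 -mulrDr lE scale1r.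
Qed.

Lemma compact_uniform_bound (V : normedModType R) (K : set V) (phi : V -> \bar R) :
  compact K ->
  (forall x, K x -> exists r u : R, 0 < r /\
     forall y, `|y - x| <= r -> (phi y < u%:E)%E) ->
  exists r u : R, 0 < r /\
    forall x y, K x -> `|y - x| <= r -> (phi y < u%:E)%E.
Proof.
move=> /compact_near_coveringP cK loc.
(* One index [i] controls both the radius and the bound, so compactness yields a single [N] for all
   of [K]. *)
pose Q (i : nat) x := forall y, `|y - x| <= i.+1%:R^-1 -> (phi y < i%:R%:E)%E.
have [|N _ NP] := cK _ \oo Q _.
  move=> x /loc[r [u [r0 ru]]].
  have r2 : 0 < r / 2 by rewrite divr_gt0.
  near=> x' i.
  have ir : (r / 2)^-1 <= i%:R by near: i; exact: nbhs_infty_ger.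
  have iu : u <= i%:R by near: i; exact: nbhs_infty_ger.
  have xx' : `|x - x'| < r / 2.
    near: x'; apply/nbhs_ballP.
    by exists (r / 2) => // z; rewrite -ball_normE.
  move=> y yx'; apply: (@lt_le_trans _ _ u%:E); last by rewrite lee_fin.
  apply: ru; rewrite -(subrKA x') (le_trans (ler_normD _ _)) //.
  have d1 : `|x' - x| < r / 2 by rewrite distrC.
  have : `|y - x'| <= r / 2; last by lra.
  apply: (le_trans yx'); rewrite invf_ple ?posrE ?ltr0n //.
  by apply: (le_trans ir); rewrite ler_nat.
exists N.+1%:R^-1, N%:R; split; first by rewrite invr_gt0 ltr0n.
by move=> x y Kx; apply: (NP N) => //=.
Unshelve. all: by end_near. Qed.

(** A Dini argument: at [x] some [D i0] comes within [e / 3] of the supremum, the common Lipschitz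
    constant carries this to neighbours of [x], and compactness makes the index uniform. *)
Lemma monotone_equilipschitz_uniformly_cauchy (V : normedModType R) (K : set V)
    (D : nat -> V -> R) (L : R) :
  compact K ->
  (forall k x, D k x <= D k.+1 x) ->
  (forall k x y, D k x <= D k y + L * `|x - y|) ->
  (forall x, K x -> exists b, forall k, D k x <= b) ->
  forall e, 0 < e -> exists N, forall j k x, (N <= j)%N -> (j <= k)%N -> K x ->
    D k x <= D j x + e.
Proof.
move=> /compact_near_coveringP cK mono lip bd e e0.
have monok j k x : (j <= k)%N -> D j x <= D k x.
  by move=> /subnK <-; elim: (k - j)%N => // i /le_trans; apply; exact: mono.
pose Q (i : nat) x := forall k, D k x <= D i x + e.
have [|N _ NP] := cK _ \oo Q _; last first.
  exists N => j k x Nj jk Kx; apply: (NP j) => //.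
move=> x /bd[b bP].
pose S := [set D k x | k in [set: nat]].
have hS : has_sup S.
  by split; [exists (D 0%N x), 0%N|exists b => _ [k _ <-]].
have e3 : 0 < e / 3 by rewrite divr_gt0.
have [_ [i0 _ <-] i0P] := sup_adherent e3 hS.
pose L' := `|L| + 1.
have L0 : 0 < L' by rewrite ltr_wpDl.
have LL' (z : V) : L * `|z| <= L' * `|z|.
  by rewrite ler_wpM2r // (le_trans (ler_norm L)) // lerDl.
near=> x' i.
have xx' : L' * `|x' - x| <= e / 3.
  rewrite mulrC -ler_pdivlMr // distrC ltW //; near: x'.
  apply/nbhs_ballP; exists (e / 3 / L') => [|z]; last by rewrite -ball_normE.
  by rewrite /= !divr_gt0.
have h3 : D i0 x <= D i x by apply: monok; near: i; exact: nbhs_infty_ge.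
move=> k.
have h1 := lip k x' x; have h2 := lip i x x'; have := LL' (x' - x).
have := LL' (x - x'); rewrite (distrC x x') in h2 *.
have kS : D k x <= sup S by apply: ub_le_sup; [exact: hS.2|exists k].
lra.
Unshelve. all: by end_near. Qed.

End Convex.

(** * Weighted sums and limits in the extended reals *)

Section Ereal.
Context (R : realType).

Lemma real_between (e : \bar R) :
  (-oo < e)%E -> (e < +oo)%E -> exists r : R, e = r%:E.
Proof. by case: e => [r||] // _ _; exists r. Qed.

Lemma lte_add_split (a b : \bar R) (u : R) :
  (-oo < a)%E -> (-oo < b)%E -> (a + b < u%:E)%E ->
  exists r s : R, [/\ a = r%:E, b = s%:E & r + s < u].
Proof.
by move: a b => [r||] [s||] //= _ _; rewrite -EFinD lte_fin => H; exists r, s.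
Qed.

(** With positive weights and no term [-oo], a single [+oo] would make the sum [+oo]. *)
Lemma lte_wsum_split (m : nat) (p : 'I_m -> R) (phi : 'I_m -> \bar R) (u : R) :
  (forall j, 0 < p j) -> (forall j, (-oo < phi j)%E) ->
  (\sum_(j < m) (p j)%:E * phi j < u%:E)%E ->
  exists r, (forall j, phi j = (r j)%:E) /\ \sum_(j < m) p j * r j < u.
Proof.
move=> p0 phiN sumlt.
have /choice[r rE] : forall j, exists r : R, phi j = r%:E.
  move=> j; apply: real_between => //; rewrite ltNge leye_eq; apply/negP => /eqP e.
  have : (\sum_(j < m) (p j)%:E * phi j = +oo)%E.
    apply/esum_eqyP; last first.
      by exists j; rewrite e gt0_muley ?lte_fin // mem_index_enum.
    by move=> i _; have := phiN i; case: (phi i) => // _; rewrite gt0_muley ?lte_fin.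
  by move=> E; rewrite E in sumlt.
exists r; split=> //; move: sumlt.
by under eq_bigr do rewrite rE -EFinM; rewrite sumEFin lte_fin.
Qed.

Lemma strictly_below_convex_wsum (V : lmodType R) (m : nat) (p : 'I_m -> R)
    (phi : 'I_m -> V -> \bar R) :
  (forall j, 0 < p j) -> \sum_(j < m) p j = 1 ->
  (forall j y, (-oo < phi j y)%E) ->
  (forall j, strictly_below_convex (phi j)) ->
  strictly_below_convex (fun y => \sum_(j < m) (p j)%:E * phi j y)%E.
Proof.
move=> p0 p1 phiN cphi a b u v l l01 /(lte_wsum_split p0 (phiN^~ a))[r [rE ru]].
move=> /(lte_wsum_split p0 (phiN^~ b))[s [sE sv]].
(* The slack of each sum is given in full to every term; as the weights sum to 1, the weighted
   bounds add up to [u] and [v] again. *)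
pose d := u - \sum_(j < m) p j * r j; pose e := v - \sum_(j < m) p j * s j.
have lt j : (phi j (l *: a + (1 - l) *: b)%R <
    (l * (r j + d) + (1 - l) * (s j + e))%:E)%E.
  by apply: cphi; rewrite // ?rE ?sE lte_fin ltrDl subr_gt0.
have /choice[t tE] : forall j, exists t : R,
    phi j (l *: a + (1 - l) *: b)%R = t%:E.
  move=> j.
  by apply: real_between => //; exact: lt_trans (lt j) (ltry _).
under eq_bigr do rewrite tE -EFinM.
rewrite sumEFin lte_fin.
have -> : l * u + (1 - l) * v =
    \sum_(j < m) p j * (l * (r j + d) + (1 - l) * (s j + e)).
  rewrite (eq_bigr (fun j => (l * (p j * r j) + (1 - l) * (p j * s j)) +
     p j * (l * d + (1 - l) * e))); last by move=> j _; ring.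
  rewrite !big_split /= -!mulr_sumr -mulr_suml p1 mul1r /d /e; ring.
(* Strictness needs a nonempty index set, which the weights summing to 1 provide. *)
apply: ltr_sum => [|j _]; last by rewrite ltr_pM2l // -lte_fin -tE.
apply/hasP; case: m p phi p0 p1 {phiN cphi r rE ru s sE sv d e lt t tE} => [|m] p phi _.
  by rewrite big_ord0 => /eqP; rewrite eq_sym oner_eq0.
by exists ord0 => //; exact: mem_index_enum.
Qed.

Lemma ereal_cvg_squeeze (u : nat -> \bar R) (v : R) :
  (forall e, 0 < e ->
    \forall k \near \oo, ((v - e)%:E <= u k <= (v + e)%:E)%E) ->
  u @ \oo --> v%:E.
Proof.
move=> H; apply/fine_cvgP; split.
  apply: filterS (H 1 ltr01) => k /andP[a b].
  by rewrite fin_numE -ltNye -ltey (lt_le_trans (ltNyr _) a) (le_lt_trans b (ltry _)).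
apply/cvgrPdist_le => e e0; apply: filterS (H e e0) => k /=.
by case: (u k) => [r||]; rewrite ?leye_eq ?leeNy_eq ?andbF //= !lee_fin ler_distlC.
Qed.

End Ereal.

(** * Comparison of the matrix sup norm with Euclidean distance and inner product *)

Section Geometry.
Context (R : realType) (n : nat).
Implicit Types x y : 'cV[R]_n.

Lemma mx_norm_le_edist x y : `|x - y| <= Defs.edist x y.
Proof.
apply: mx_norm_le => [|i j]; first exact: sqrtr_ge0.
rewrite (ord1 j) -sqrtr_sqr ler_sqrt ?sqr_ge0 //; last first.
  by apply: sumr_ge0 => k _; exact: sqr_ge0.
rewrite !mxE /sqdist (bigD1 i) //= lerDl.
by apply: sumr_ge0 => k _; exact: sqr_ge0.
Qed.

Lemma sqdist_ge0 x y : 0 <= sqdist x y.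
Proof. by apply: sumr_ge0 => k _; exact: sqr_ge0. Qed.

Lemma sqdist_le x y (r : R) : `|x - y| <= r -> sqdist x y <= n%:R * r ^+ 2.
Proof.
move=> xyr; rewrite mulr_natl -[X in _ *+ X]card_ord -sumr_const.
apply: ler_sum => i _; have := le_trans (le_mx_norm (x - y) i ord0) xyr.
rewrite !mxE => H; rewrite -real_normK ?num_real //.
by rewrite lerXn2r // nnegrE // (le_trans _ H).
Qed.

Lemma edist_le x y (r : R) : `|x - y| <= r -> Defs.edist x y <= n%:R * r.
Proof.
move=> xyr; have r0 : 0 <= r by exact: le_trans xyr.
have nr0 : 0 <= n%:R * r by rewrite mulr_ge0.
rewrite -[leRHS](ger0_norm nr0) -sqrtr_sqr ler_sqrt ?sqr_ge0 //.
apply: (le_trans (sqdist_le xyr)); rewrite exprMn ler_wpM2r ?sqr_ge0 //.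
by rewrite -natrX ler_nat; case: (n) => // k; rewrite leq_pmulr.
Qed.

Lemma dotv_le x y : `|dotv x y| <= n%:R * (`|x| * `|y|).
Proof.
rewrite (le_trans (ler_norm_sum _ _ _)) // mulr_natl -[X in _ *+ X]card_ord.
rewrite -sumr_const; apply: ler_sum => i _.
by rewrite normrM ler_pM // le_mx_norm.
Qed.

Lemma dotvB x y z : dotv x (y - z) = dotv x y - dotv x z.
Proof. by rewrite -sumrB; apply: eq_bigr => i _; rewrite !mxE mulrBr. Qed.

Lemma dotv_delta x i (r : R) : dotv x (r *: delta_mx i ord0) = r * x i ord0.
Proof.
rewrite /dotv (bigD1 i) //= big1 ?addr0 => [|j /negPf ji].
  by rewrite !mxE !eqxx mulr1 mulrC.
by rewrite !mxE ji mulr0 mulr0.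
Qed.

Lemma dotv_wsum (m : nat) (p : 'I_m -> R) (v : 'I_m -> 'cV[R]_n) y :
  dotv (\sum_(j < m) p j *: v j) y = \sum_(j < m) p j * dotv (v j) y.
Proof.
rewrite /dotv; under [RHS]eq_bigr do rewrite mulr_sumr.
rewrite exchange_big /=; apply: eq_bigr => i _.
by rewrite summxE mulr_suml; apply: eq_bigr => j _; rewrite !mxE mulrA.
Qed.

Lemma mulmx_entry_le (m : nat) (A : 'M[R]_(m, n)) (y : 'cV[R]_n) i :
  `|(A *m y) i ord0| <= n%:R * (`|A| * `|y|).
Proof.
have -> : (A *m y) i ord0 = dotv (row i A)^T y.
  by rewrite mxE; apply: eq_bigr => j _; rewrite !mxE.
apply: le_trans (dotv_le _ _) _; rewrite ler_wpM2l // ler_wpM2r //.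
by apply: mx_norm_le => // j k; rewrite !mxE; exact: le_mx_norm.
Qed.

Lemma enlarge_locally_bounded (phi : 'cV[R]_n -> \bar R) (X : set 'cV[R]_n)
    (e : R) y :
  strictly_below_convex phi -> 0 < e ->
  (forall z, enlarge X e z -> (phi z < +oo)%E) -> X y ->
  exists r u : R, 0 < r /\ forall z, `|z - y| <= r -> (phi z < u%:E)%E.
Proof.
(* Euclidean distance is at most [n] times the sup norm; [n.+1] keeps the divisor positive in
   dimension 0. *)
move=> cphi e0 fin Xy; apply: (@convex_locally_bounded _ _ _ _ (e / n.+1%:R)) => //.
  by rewrite divr_gt0 // ltr0n.
move=> z zy; apply: fin; exists y => //; apply: le_trans (edist_le zy) _.
rewrite mulrCA ger_pMr // ler_pdivrMr ?ltr0n // mul1r ler_nat; exact: leqnSn.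
Qed.

Lemma compact_sqdist_bounded (X : set 'cV[R]_n) : compact X ->
  exists2 D, 0 <= D & forall x y, X x -> X y -> sqdist x y <= D.
Proof.
move=> /compact_bounded[B [_ HB]].
have {}HB : forall x, X x -> `|x| <= `|B| + 1.
  by apply: HB; rewrite (le_lt_trans (ler_norm B)) // ltrDl.
exists (n%:R * (2 * (`|B| + 1)) ^+ 2) => [|x y Xx Xy].
  by rewrite mulr_ge0 // sqr_ge0.
apply: sqdist_le; rewrite mulr2n mulrDl mul1r.
by rewrite (le_trans (ler_normB _ _)) // lerD // HB.
Qed.

End Geometry.

(** * The one-stage problem: convexity of its value and effect of the prox term *)

Section Program.
Context (R : realType) (n K M : nat) (P : msp R n K M).
Implicit Types (x y z : 'cV[R]_n) (xi : 'rV[R]_K) (Qn : 'cV[R]_n -> \bar R).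

Lemma Qinf_le t Qn x xi y :
  feas P t x xi y -> (Qinf P t Qn x xi <= mf P t x y xi + Qn y)%E.
Proof. by move=> fy; apply: ereal_inf_lbound; exists y. Qed.

Lemma Qinf_le_mono t Qn Qn' x xi :
  (forall y, (Qn y <= Qn' y)%E) -> (Qinf P t Qn x xi <= Qinf P t Qn' x xi)%E.
Proof.
move=> QQ; apply: le_ereal_inf_tmp => _ [y fy <-].
by apply: (le_trans (Qinf_le Qn fy)); exact: leeD2l.
Qed.

Lemma Qv_last : Qv P (mT P).+1 = fun=> 0%E.
Proof. by rewrite /Qv addn1 subnn. Qed.

Lemma Qv_rec t x : (1 <= t <= mT P)%N ->
  Qv P t x = (\sum_(j < M) (mp P t j)%:E * Qfrak P t x (mxi P t j))%E.
Proof.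
move=> /andP[t1 tT].
have e : (mT P + 1 - t = (mT P - t).+1)%N by rewrite addn1 subSn.
by rewrite /Qfrak /Qv e /= subKn // addn1 subSS.
Qed.

Section Convexity.
Hypothesis h2 : H2 P.
Variables (t : nat) (xi : 'rV[R]_K).
Hypotheses (tT : (1 <= t <= mT P)%N) (sxi : supp P t xi).

Lemma cost_gtNy x y : (-oo < mf P t x y xi)%E.
Proof.
by have [_ [_ /(_ _ sxi)[[_ fN] _ _]] _ _ _] := h2 tT; have := fN (x, y).
Qed.

Lemma feas_convex a b ya yb (l : R) : 0 < l < 1 ->
  feas P t a xi ya -> feas P t b xi yb ->
  feas P t (l *: a + (1 - l) *: b) xi (l *: ya + (1 - l) *: yb).
Proof.
move=> l01 [Xa ga La] [Xb gb Lb]; have /andP[l0 l1] := l01.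
have [[_ [cX _]] _ cg _ _] := h2 tT.
split.
- have /(_ (Itv01 (ltW l0) (ltW l1))) := cX ya yb.
  by rewrite !inE => /(_ Xa Xb).
- move=> i; have [cgi _] := cg _ sxi i.
  have := cgi (a, ya) (b, yb) l l01; rewrite /= -!EFinM -EFinD lee_fin.
  move/le_trans; apply; have := ga i; have := gb i; nra.
- rewrite !mulmxDr -!scalemxAr addrACA -!scalerDr La Lb -scalerDl.
  by rewrite subrKC scale1r.
Qed.

(** An infimum below [u] has a feasible witness below [u]; the combination of the two witnesses is
    feasible for the combined parent and competes in its infimum. *)
Lemma Qinf_convex Qn : strictly_below_convex Qn -> (forall y, (-oo < Qn y)%E) ->
  strictly_below_convex (fun x => Qinf P t Qn x xi).
Proof.
move=> cQ QN a b u v l l01 /ereal_inf_lt[_ [ya fa <-]] au.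
move=> /ereal_inf_lt[_ [yb fb <-]] bv.
have [fau [qau [faE qaE sau]]] := lte_add_split (cost_gtNy a ya) (QN ya) au.
have [fbu [qbu [fbE qbE sbu]]] := lte_add_split (cost_gtNy b yb) (QN yb) bv.
apply: le_lt_trans (Qinf_le Qn (feas_convex l01 fa fb)) _.
have [_ [_ /(_ _ sxi)[_ cf _]] _ _ _] := h2 tT.
have := cf (a, ya) (b, yb) l l01; rewrite /= faE fbE -!EFinM -EFinD => hf.
have := cQ ya yb (u - fau) (v - fbu) l l01.
rewrite qaE qbE !lte_fin => /(_ ltac:(lra) ltac:(lra)) hq.
apply: le_lt_trans (leeD2r _ hf) _.
move: hq; case: (Qn _) (QN (l *: ya + (1 - l) *: yb)) => [q||] // _.
by rewrite -EFinD !lte_fin; lra.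
Qed.

Lemma cost_fin_of_enlarge (e : R) x y :
  (forall x y, enlarge (Xs P t.-1) e x -> mX P t y ->
            edom (fun z : 'cV[R]_n * 'cV[R]_n => mf P t z.1 z.2 xi) (x, y)) ->
  enlarge (Xs P t.-1) e x -> mX P t y -> exists r : R, mf P t x y xi = r%:E.
Proof. by move=> He xe Xy; apply: real_between (cost_gtNy _ _) (He _ _ xe Xy). Qed.

(** Every competitor and the prox-center lie in the stage set, so the penalty at any competitor is
    at most [lam * D]. *)
Lemma Fbar_le_Qinf Qn (lam D : R) xp x y :
  0 <= lam -> mX P t xp ->
  (forall a b, mX P t a -> mX P t b -> sqdist a b <= D) ->
  is_argmin (feas P t x xi) (Fbar P t xi Qn lam xp x) y ->
  (Fbar P t xi Qn lam xp x y <= Qinf P t Qn x xi + (lam * D)%:E)%E.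
Proof.
move=> lam0 Xp dD [fy ymin]; rewrite -leeBlDr //.
apply: le_ereal_inf_tmp => _ [z fz <-]; rewrite leeBlDr //.
apply: le_trans (ymin z fz) _; apply: leeD2l; rewrite lee_fin ler_wpM2l //.
by apply: dD => //; case: fz.
Qed.

Lemma le_Fbar Qn (lam : R) xp x y : 0 <= lam ->
  (mf P t x y xi + Qn y <= Fbar P t xi Qn lam xp x y)%E.
Proof.
by move=> lam0; rewrite /Fbar leeDl // lee_fin mulr_ge0 // sqdist_ge0.
Qed.

End Convexity.

Lemma enlarge_self (X : set 'cV[R]_n) e x : 0 <= e -> X x -> enlarge X e x.
Proof.
move=> e0 Xx; exists x => //; rewrite /Defs.edist /sqdist big1 ?sqrtr0 // => i _.
by rewrite subrr expr0n.
Qed.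

End Program.

(** * Analysis of SREDA along a fixed sample path *)

Section Path.
Context (R : realType) (n K M : nat) (P : msp R n K M).
Context d (Omega : measurableType d) (smp : Omega -> nat -> nat -> 'I_M).
Context (lam : nat -> nat -> R) (Q0 : nat -> 'cV[R]_n -> \bar R).
Context (xP : Omega -> nat -> nat -> 'cV[R]_n).
Context (x : Omega -> nat -> seq 'I_M -> 'cV[R]_n).
Context (pi : Omega -> nat -> nat -> 'I_M -> 'cV[R]_n).
Context (Qc : Omega -> nat -> nat -> 'cV[R]_n -> \bar R).
Hypotheses (h1 : H1 P) (h2 : H2 P).
Hypothesis sreda : SREDA P smp lam Q0 xP x pi Qc.
Variable w : Omega.
Local Notation T := (mT P).

Lemma lam_ge0 t k : 0 <= lam t k.
Proof. by have [[l0 _] _ _ _ _] := sreda. Qed.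

Lemma prox_in k t : (1 <= k)%N -> (1 <= t <= T)%N -> mX P t (xP w k t).
Proof. by have [_ [+ _] _ _ _] := sreda; apply. Qed.

Lemma Qc_last k : Qc w k T.+1 = fun=> 0%E.
Proof. by have [_ _ [_ ->] _ _] := sreda. Qed.

Lemma forward1 k : (1 <= k)%N ->
  is_argmin (feas P 1 (mx0 P) (mxi1 P))
    (Fbar P 1 (mxi1 P) (Qc w k.-1 2%N) (lam 1%N k) (xP w k 1%N) (mx0 P))
    (x w k [::]).
Proof. by move=> k1; have [_ _ _ /(_ w k k1)[+ _] _] := sreda. Qed.

Lemma forward k t nd j : (1 <= k)%N -> (2 <= t <= T)%N ->
  size nd = (t - 2)%N ->
  is_argmin (feas P t (x w k nd) (mxi P t j))
    (Fbar P t (mxi P t j) (Qc w k.-1 t.+1) (lam t k) (xP w k t) (x w k nd))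
    (x w k (rcons nd j)).
Proof. by move=> k1 tT s; have [_ _ _ /(_ w k k1)[_ +] _] := sreda; apply. Qed.

Lemma supp1 : supp P 1 (mxi1 P). Proof. by left. Qed.

Lemma suppj t j : (2 <= t)%N -> supp P t (mxi P t j).
Proof. by right; split => //; exists j. Qed.

Lemma range_ge1 t : (2 <= t <= T)%N -> (1 <= t <= T)%N.
Proof. by move=> /andP[/ltnW -> ->]. Qed.

Lemma XsS t : (1 <= t)%N -> Xs P t = mX P t.
Proof. by case: t. Qed.

Lemma decision_in k nd : (1 <= k)%N -> (size nd < T)%N ->
  mX P (size nd).+1 (x w k nd).
Proof.
move=> k1; case/lastP: nd => [|nd j] sT; first by have [[]] := forward1 k1.
rewrite size_rcons in sT *.
by have [||[]] := @forward k (size nd).+2 nd j k1; rewrite ?subn2.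
Qed.

Lemma decision_in_prev k t nd : (1 <= k)%N -> (2 <= t <= T.+1)%N ->
  size nd = (t - 2)%N -> mX P t.-1 (x w k nd).
Proof.
case: t => [|[|t]] // k1 tT; rewrite subn2 /= => s.
by have := @decision_in k nd k1; rewrite s; apply.
Qed.

Lemma size_snode k t : (2 <= t)%N -> size (snode (smp w) k t.-1) = (t - 2)%N.
Proof. by move=> t2; rewrite size_map size_iota subn2. Qed.

Lemma prob_gt0 t j : (2 <= t <= T)%N -> 0 < mp P t j.
Proof. by move=> /h1[_ + _]; apply. Qed.

Lemma prob_sum t : (2 <= t <= T)%N -> \sum_(j < M) mp P t j = 1.
Proof. by move=> /h1[]. Qed.

Lemma backward_ind (Q : nat -> Prop) : Q T.+1 ->
  (forall t, (2 <= t <= T)%N -> Q t.+1 -> Q t) ->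
  forall t, (2 <= t <= T.+1)%N -> Q t.
Proof.
move=> QT QS t /andP[t2 tT]; move: t2; rewrite -(subKn tT).
elim: (T.+1 - t)%N (leq_subr t T.+1) => [|i IH] iT t2; first by rewrite subn0.
apply: QS; first by rewrite t2 /= subSS leq_subr.
rewrite subSS -subSn //; apply: IH; first exact: ltnW.
by rewrite (leq_trans t2) // leq_sub2l.
Qed.

Definition trial k t := x w k (snode (smp w) k t.-1).
Definition Qlow k t j y := Qinf P t (Qc w k t.+1) y (mxi P t j).
Definition slope k t : 'cV[R]_n := \sum_(j < M) mp P t j *: pi w k t j.
(** A real-valued form of the cut: [fine] loses nothing, since [subgrad] makes [Qlow] finite at the
    trial point. *)
Definition cut k t y : R :=
  \sum_(j < M) mp P t j * fine (Qlow k t j (trial k t)) +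
  dotv (slope k t) (y - trial k t).

Lemma trial_in k t : (1 <= k)%N -> (2 <= t <= T)%N -> mX P t.-1 (trial k t).
Proof.
move=> k1 /andP[t2 tT]; apply: decision_in_prev; rewrite ?size_snode //.
by rewrite t2 ltnW.
Qed.

Lemma Qlow_subgrad k t j y : (1 <= k)%N -> (2 <= t <= T)%N ->
  ((fine (Qlow k t j (trial k t)) + dotv (pi w k t j) (y - trial k t))%:E
     <= Qlow k t j y)%E.
Proof.
move=> k1 tT; have [_ _ _ _ /(_ w k t k1 tT)[/(_ j)[fin sub] _]] := sreda.
by rewrite EFinD fineK //; exact: sub.
Qed.

Lemma Qlow_trial k t j : (1 <= k)%N -> (2 <= t <= T)%N ->
  Qlow k t j (trial k t) = (fine (Qlow k t j (trial k t)))%:E.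
Proof.
move=> k1 tT; have [_ _ _ _ /(_ w k t k1 tT)[/(_ j)[fin _] _]] := sreda.
by rewrite fineK.
Qed.

Lemma Qc_rec k t y : (1 <= k)%N -> (2 <= t <= T)%N ->
  Qc w k t y = Order.max (Qc w k.-1 t y) (cut k t y)%:E.
Proof.
move=> k1 tT; have [_ _ _ _ /(_ w k t k1 tT)[_ ->]] := sreda.
congr Order.max; rewrite EFinD; congr (_ + _)%E.
by rewrite -sumEFin; apply: eq_bigr => j _; rewrite EFinM -Qlow_trial.
Qed.

Lemma cut_le k t y : (1 <= k)%N -> (2 <= t <= T)%N ->
  ((cut k t y)%:E <= \sum_(j < M) (mp P t j)%:E * Qlow k t j y)%E.
Proof.
move=> k1 tT; rewrite /cut dotv_wsum -big_split /= -sumEFin.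
apply: lee_sum => j _; rewrite -mulrDr EFinM.
by apply: lee_wpmul2l; [rewrite lee_fin ltW // prob_gt0|exact: Qlow_subgrad].
Qed.

(** Backward induction on the stage, then induction on [k]: a cut lies below the mean of [Qlow],
    which is the exact recursion with a smaller next-stage function. *)
Lemma Qc_le_Qv t : (2 <= t <= T.+1)%N -> forall k y, (Qc w k t y <= Qv P t y)%E.
Proof.
move: t; apply: backward_ind => [k y|t tT IH]; first by rewrite Qc_last Qv_last.
elim=> [|k IHk] y.
  by have [[_ [_ [_ Q0v]]] _ [-> // _] _ _] := sreda; exact: Q0v.
rewrite Qc_rec // ge_max IHk /= Qv_rec ?range_ge1 //.
apply: (le_trans (cut_le y (ltn0Sn k) tT)); apply: lee_sum => j _.
apply: lee_wpmul2l; first by rewrite lee_fin ltW // prob_gt0.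
by apply: Qinf_le_mono => z; exact: IH.
Qed.

Lemma Qc_mono t j k y : (2 <= t <= T.+1)%N -> (j <= k)%N ->
  (Qc w j t y <= Qc w k t y)%E.
Proof.
move=> /andP[t2]; rewrite leq_eqVlt => /orP[/eqP ->|tT]; first by rewrite !Qc_last.
move=> /subnK <-; elim: (k - j)%N => // i /le_trans; apply.
by rewrite addSn [leRHS]Qc_rec ?t2 //= le_max lexx.
Qed.

Lemma range_succ t : (2 <= t <= T)%N -> (2 <= t.+1 <= T.+1)%N.
Proof. by case/andP => t2 tT; apply/andP; split; first exact: ltnW. Qed.

Lemma range_weak t : (2 <= t <= T)%N -> (2 <= t <= T.+1)%N.
Proof. by case/andP => -> /leqW ->. Qed.

(** The affine minorant from iteration 1 serves all later iterations; it gives a finite lower bound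
    even when the initial [Q0] is [-oo]. *)
Lemma Qlow_ge k t j y : (1 <= k)%N -> (2 <= t <= T)%N ->
  ((fine (Qlow 1 t j (trial 1 t)) + dotv (pi w 1 t j) (y - trial 1 t))%:E
     <= Qlow k t j y)%E.
Proof.
move=> k1 tT; apply: le_trans (Qlow_subgrad j y (ltn0Sn 0) tT) _.
by apply: Qinf_le_mono => z; apply: Qc_mono => //; exact: range_succ.
Qed.

Lemma Qlow_le_Qfrak k t j y : (2 <= t <= T)%N ->
  (Qlow k t j y <= Qfrak P t y (mxi P t j))%E.
Proof.
by move=> tT; apply: Qinf_le_mono => z; apply: Qc_le_Qv; exact: range_succ.
Qed.

Lemma Qfrak_gtNy t j y : (2 <= t <= T)%N -> (-oo < Qfrak P t y (mxi P t j))%E.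
Proof.
move=> tT; apply: lt_le_trans (Qlow_le_Qfrak 1 j y tT).
by apply: lt_le_trans (Qlow_ge j y (ltn0Sn 0) tT); rewrite ltNyr.
Qed.

Lemma Qc_gtNy k t y : (1 <= k)%N -> (2 <= t <= T.+1)%N -> (-oo < Qc w k t y)%E.
Proof.
move=> k1 /andP[t2]; rewrite leq_eqVlt => /orP[/eqP ->|tT]; first by rewrite Qc_last.
by rewrite Qc_rec ?t2 // lt_max ltNyr orbT.
Qed.

Lemma Qv_gtNy t y : (2 <= t <= T.+1)%N -> (-oo < Qv P t y)%E.
Proof. by move=> tT; apply: lt_le_trans (Qc_le_Qv tT 1 y); exact: Qc_gtNy. Qed.

(** * Convexity, finiteness and semicontinuity of the exact value functions *)

Lemma Qv_convex t : (2 <= t <= T.+1)%N -> strictly_below_convex (Qv P t).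
Proof.
move: t; apply: backward_ind => [|t tT IH].
  rewrite Qv_last => a b u v l /andP[l0 l1]; rewrite !lte_fin => u0 v0.
  by rewrite addr_gt0 // mulr_gt0 // subr_gt0.
rewrite (_ : Qv P t = fun y =>
  (\sum_(j < M) (mp P t j)%:E * Qfrak P t y (mxi P t j))%E); last first.
  by apply/funext => y; rewrite Qv_rec // range_ge1.
apply: strictly_below_convex_wsum.
- by move=> j; exact: prob_gt0.
- exact: prob_sum.
- by move=> j y; exact: Qfrak_gtNy.
- move=> j; apply: (Qinf_convex h2 (range_ge1 tT) (suppj _ _) IH).
    by case/andP: tT.
  by move=> y; apply: Qv_gtNy; exact: range_succ.
Qed.

Lemma Qfrak_convex t j : (2 <= t <= T)%N ->
  strictly_below_convex (fun y => Qfrak P t y (mxi P t j)).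
Proof.
move=> tT; apply: (Qinf_convex h2 (range_ge1 tT) (suppj _ _)).
- by case/andP: tT.
- by apply: Qv_convex; exact: range_succ.
- by move=> y; apply: Qv_gtNy; exact: range_succ.
Qed.

(** On the enlargement of (H2) every parent has a feasible child of finite cost, and that child lies
    in [mX P t]; finiteness of [Qn] on that set alone is enough, which lets the backward induction
    proceed. *)
Lemma Qinf_fin_near t Qn : (1 <= t <= T)%N ->
  (forall y, mX P t y -> (Qn y < +oo)%E) ->
  exists2 e, 0 < e & forall xi y, supp P t xi -> enlarge (Xs P t.-1) e y ->
     (Qinf P t Qn y xi < +oo)%E.
Proof.
move=> tT Qfin; have [_ _ _ [e e0 He] _] := h2 tT.
exists e => // xi y sxi ye; have [Hf /(_ y ye)[z fz]] := He _ sxi.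
apply: le_lt_trans (Qinf_le Qn fz) _.
by apply: lte_add_pinfty; [apply: (Hf y z)|apply: Qfin] => //; case: fz.
Qed.

Lemma Qv_fin_near t : (2 <= t <= T.+1)%N ->
  exists2 e, 0 < e & forall y, enlarge (mX P t.-1) e y -> (Qv P t y < +oo)%E.
Proof.
move: t; apply: backward_ind => [|t tT [e e0 He]].
  by exists 1 => // y _; rewrite Qv_last.
have t1 : (1 <= t <= T)%N := range_ge1 tT; have t2 : (2 <= t)%N by case/andP: tT.
have [y Xy|e' e'0 He'] := @Qinf_fin_near t (Qv P t.+1) t1.
  by apply: He; exact: enlarge_self (ltW e0) Xy.
exists e' => // y ye; rewrite Qv_rec //; apply: lte_sum_pinfty => j _.
have [|r rE] := real_between (Qfrak_gtNy j y tT).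
  by apply: He' (suppj _ t2) _; rewrite XsS //; case: (t) t2 => [|[|]].
by rewrite rE -EFinM ltry.
Qed.

Lemma Qv_real t y : (2 <= t <= T.+1)%N -> mX P t.-1 y ->
  exists r : R, Qv P t y = r%:E.
Proof.
move=> tT Xy; apply: real_between (Qv_gtNy _ tT) _.
have [e e0 He] := Qv_fin_near tT; apply: He.
exact: enlarge_self (ltW e0) Xy.
Qed.

Lemma Qfrak_fin_near t j : (2 <= t <= T)%N ->
  exists2 e, 0 < e & forall y, enlarge (mX P t.-1) e y ->
    (Qfrak P t y (mxi P t j) < +oo)%E.
Proof.
move=> tT; have t2 : (2 <= t)%N by case/andP: tT.
have [y Xy|e e0 He] := @Qinf_fin_near t (Qv P t.+1) (range_ge1 tT).
  by have [r ->] := Qv_real (range_succ tT) Xy; rewrite ltry.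
by exists e => // y ye; apply: He (suppj _ t2) _; rewrite XsS //; case: (t) t2 => [|[|]].
Qed.

Lemma Qfrak_locally_bounded t j y : (2 <= t <= T)%N -> mX P t.-1 y ->
  exists r u : R, 0 < r /\
    forall z, `|z - y| <= r -> (Qfrak P t z (mxi P t j) < u%:E)%E.
Proof.
move=> tT Xy; have [e e0 He] := Qfrak_fin_near j tT.
exact: (enlarge_locally_bounded (Qfrak_convex (j:=j) tT) e0 He Xy).
Qed.

Lemma Qfrak_usc t j y (e : R) : (2 <= t <= T)%N -> mX P t.-1 y -> 0 < e ->
  exists2 h, 0 < h & forall z, `|z - y| < h ->
    (Qfrak P t z (mxi P t j) <= Qfrak P t y (mxi P t j) + e%:E)%E.
Proof.
move=> tT Xy e0; have [r [u [r0 ru]]] := Qfrak_locally_bounded j tT Xy.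
have [|v vE] := real_between (Qfrak_gtNy j y tT).
  by apply: lt_trans (ru y _) (ltry _); rewrite subrr normr0 ltW.
have [h h0 hP] := convex_continuous (Qfrak_convex (j:=j) tT) vE r0 ru e0.
by exists h => // z /hP[_]; rewrite vE -EFinD => /ltW.
Qed.

Lemma Qv_lsc t y (e : R) : (2 <= t <= T.+1)%N -> mX P t.-1 y -> 0 < e ->
  exists2 h, 0 < h & forall z, `|z - y| < h -> (Qv P t y <= Qv P t z + e%:E)%E.
Proof.
move=> tT Xy e0; have [v vE] := Qv_real tT Xy.
have [a a0 Ha] := Qv_fin_near tT.
have [r [u [r0 ru]]] := enlarge_locally_bounded (Qv_convex tT) a0 Ha Xy.
have [h h0 hP] := convex_continuous (Qv_convex tT) vE r0 ru e0.
by exists h => // z /hP[+ _]; rewrite vE -leeBlDr // => /ltW.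
Qed.

(** * Bounded cut slopes and vanishing increments *)

Lemma stage_compact t : (1 <= t <= T)%N -> compact (mX P t).
Proof. by move=> /h2[[_ [_ +]] _ _ _ _]. Qed.

Lemma prev_range t : (2 <= t <= T.+1)%N -> (1 <= t.-1 <= T)%N.
Proof. by case: t => [|[|t]]. Qed.

(** The subgradient inequality is tested at the trial point shifted by [+- r e_i]: there [Qlow] is
    below the uniform bound [u] of [Qfrak], while at the trial point it is at least [L], so each
    entry of the subgradient is at most [(u - L) / r] in absolute value. *)
Lemma pi_bounded t j : (2 <= t <= T)%N ->
  exists B : R, forall k, (1 <= k)%N -> `|pi w k t j| <= B.
Proof.
move=> tT; have cX := stage_compact (prev_range (range_weak tT)).
have [r [u [r0 ru]]] := compact_uniform_bound cX
  (fun y Xy => Qfrak_locally_bounded j tT Xy).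
have [D [_ HD]] := compact_bounded cX.
have {}HD y : mX P t.-1 y -> `|y| <= `|D| + 1.
  by move=> Xy; apply: HD Xy; rewrite (le_lt_trans (ler_norm D)) // ltrDl.
pose c := fine (Qlow 1 t j (trial 1 t)).
(* Minimum over the stage set of the iteration-1 minorant, estimated through the diameter
   [2 (|D| + 1)]. *)
pose L := c - n%:R * (`|pi w 1 t j| * (2 * (`|D| + 1))).
have Qlow_trial_ge k : (1 <= k)%N -> L <= fine (Qlow k t j (trial k t)).
  move=> k1; rewrite -lee_fin -Qlow_trial //.
  apply: le_trans (Qlow_ge j (trial k t) k1 tT).
  rewrite lee_fin /L lerD2l lerNl.
  apply: le_trans (ler_norm _) _; rewrite normrN.
  apply: le_trans (dotv_le _ _) _; rewrite !ler_wpM2l //.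
  rewrite mulr2n mulrDl mul1r; apply: le_trans (ler_normB _ _) _.
  by rewrite lerD // HD //; exact: trial_in.
exists ((u - L) / r) => k k1.
have step (s : R) i : `|s| = r -> s * pi w k t j i ord0 <= u - L.
  move=> sr; have := Qlow_subgrad j (trial k t + s *: delta_mx i ord0) k1 tT.
  rewrite addrAC subrr add0r dotv_delta => h.
  have : (Qlow k t j (trial k t + s *: delta_mx i ord0)%R < u%:E)%E.
    apply: le_lt_trans (Qlow_le_Qfrak k j _ tT) _.
    apply: ru (trial_in k1 tT) _; rewrite addrAC subrr add0r -sr.
    apply: mx_norm_le => // a b; rewrite !mxE; case: (_ && _) => /=.
      by rewrite mulr1.
    by rewrite mulr0 normr0.
  move=> /(le_lt_trans h); rewrite lte_fin; have := Qlow_trial_ge k k1; lra.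
have uL : 0 <= u - L.
  have := ru _ (trial k t) (trial_in k1 tT).
  rewrite subrr normr0 => /(_ (ltW r0)) /(le_lt_trans (Qlow_le_Qfrak k j _ tT)).
  by rewrite Qlow_trial // lte_fin; have := Qlow_trial_ge k k1; lra.
apply: mx_norm_le => [|i a]; first by rewrite divr_ge0 // ltW.
rewrite (ord1 a) ler_pdivlMr // mulrC.
have r1 : `|r| = r by rewrite gtr0_norm.
case: (lerP 0 (pi w k t j i ord0)) => p0.
  by rewrite ger0_norm //; exact: step.
by rewrite ltr0_norm // mulrN -mulNr; apply: step; rewrite normrN.
Qed.

Lemma slope_bounded t : (2 <= t <= T)%N ->
  exists B : R, forall k, (1 <= k)%N -> `|slope k t| <= B.
Proof.
move=> tT; have /choice[B BP] := fun j => pi_bounded j tT.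
exists (\sum_(j < M) mp P t j * B j) => k k1.
apply: le_trans (ler_norm_sum _ _ _) _; apply: ler_sum => j _.
by rewrite normrZ gtr0_norm ?prob_gt0 // ler_wpM2l ?BP // ltW // prob_gt0.
Qed.

Lemma cut_lipschitz t : (2 <= t <= T)%N ->
  exists L : R, forall k y z, (1 <= k)%N -> cut k t y <= cut k t z + L * `|y - z|.
Proof.
move=> tT; have [B BP] := slope_bounded tT; exists (n%:R * B) => k y z k1.
rewrite /cut -addrA lerD2l !dotvB -lerBlDl opprB addrA subrK -dotvB -mulrA.
apply: le_trans (ler_norm _) _; apply: le_trans (dotv_le _ _) _.
by rewrite ler_wpM2l // ler_wpM2r // BP.
Qed.

(* Only the cut part of [Q_t^k = max(Q_t^0, cuts)] is equi-Lipschitz; the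
   arbitrary initial minorant [Q_t^0] cancels in the increment. *)
Lemma Qc_increment t (e : R) : (2 <= t <= T.+1)%N -> 0 < e ->
  \forall k \near \oo, forall y, mX P t.-1 y ->
    (Qc w k t y <= Qc w k.-1 t y + e%:E)%E.
Proof.
move=> /[dup] tT1 /andP[t2]; rewrite leq_eqVlt => /orP[/eqP -> e0|tT e0].
  by near=> k => y _; rewrite !Qc_last add0e lee_fin ltW.
have {}tT : (2 <= t <= T)%N by rewrite t2.
(* [D k] is the maximum of the cuts 1 to [k + 1], hence the shift between [D k] and [Qc w k.+1], and
   [N.+2] as final rank. *)
pose D := fix D k y : R :=
  if k is k'.+1 then Num.max (D k' y) (cut k.+1 t y) else cut 1 t y.
have QcD k y : Qc w k.+1 t y = Order.max (Qc w 0 t y) (D k y)%:E.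
  elim: k => [|k IH]; first by rewrite Qc_rec.
  by rewrite Qc_rec //= IH -maxA EFin_max.
have [L LP] := cut_lipschitz tT.
have cX := stage_compact (prev_range tT1).
have [||y Xy|N HN] := @monotone_equilipschitz_uniformly_cauchy _ _ _ D L cX _ _ _ e e0.
- by move=> k y /=; rewrite le_max lexx.
- elim=> [|k IH] y z /=; first exact: LP.
  rewrite ge_max; apply/andP; split; first apply: le_trans (IH y z) _.
    by rewrite lerD2r le_max lexx.
  by apply: le_trans (LP _ y z _) _ => //; rewrite lerD2r le_max lexx orbT.
- have [b bE] := Qv_real tT1 Xy; exists b => k; rewrite -lee_fin -bE.
  by apply: le_trans (Qc_le_Qv tT1 k.+1 y); rewrite QcD le_max lexx orbT.
exists N.+2 => // -[|[|k]] // Nk y Xy; rewrite [k.+2.-1]/= !QcD.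
rewrite ge_max; apply/andP; split.
  rewrite -[leLHS]adde0; apply: leeD; last by rewrite lee_fin ltW.
  by rewrite le_max lexx.
apply: (@le_trans _ _ (D k y + e)%:E); first by rewrite lee_fin; apply: HN.
by rewrite EFinD; apply: leeD2r; rewrite le_max lexx orbT.
Unshelve. all: by end_near. Qed.

(** * Vanishing of the gaps at the nodes of the tree *)

Hypothesis lam_cvg : forall t, (1 <= t <= T)%N -> lam t @ \oo --> 0.

Lemma penalty_vanishes t : (1 <= t <= T)%N ->
  exists D : R, (forall a b, mX P t a -> mX P t b -> sqdist a b <= D) /\
    forall e, 0 < e -> \forall k \near \oo, lam t k * D <= e.
Proof.
move=> tT; have [D D0 DP] := compact_sqdist_bounded (stage_compact tT).
exists D; split => // e e0.
have eD : 0 < e / (D + 1) by rewrite divr_gt0 // ltr_wpDl.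
have /cvgrPdist_le/(_ _ eD) := lam_cvg tT.
apply: filterS => k; rewrite add0r normrN ger0_norm ?lam_ge0 // => lk.
have : lam t k * (D + 1) <= e by rewrite -ler_pdivlMr // ltr_wpDl.
by apply: le_trans; rewrite ler_wpM2l ?lam_ge0 // lerDl.
Qed.

Lemma Qfrak_le_Fbar t k xi a b (e : R) :
  feas P t a xi b -> (Qv P t.+1 b <= Qc w k.-1 t.+1 b + e%:E)%E ->
  (Qfrak P t a xi <=
    Fbar P t xi (Qc w k.-1 t.+1) (lam t k) (xP w k t) a b + e%:E)%E.
Proof.
move=> fb Qb; apply: le_trans (Qinf_le _ fb) _.
apply: le_trans (leeD2l _ Qb) _; rewrite addeA; apply: leeD2r.
by apply: le_Fbar; exact: lam_ge0.
Qed.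

(** The gap is taken against [Qc w k.-1], the model used by the forward pass; with the decision at
    [k] it depends only on samples before [k]. *)
Definition gap_vanishes t nd := forall e : R, 0 < e ->
  \forall k \near \oo,
    (Qv P t (x w k nd) <= Qc w k.-1 t (x w k nd) + e%:E)%E.

(** Three errors of [e / 3]: the gaps at the children, the prox penalty, and the increment from
    iteration [k - 1] to [k], which brings the new cut back to the old model. *)
Lemma selected_gap t nd (e : R) : (2 <= t <= T)%N -> size nd = (t - 2)%N ->
  (forall j, gap_vanishes t.+1 (rcons nd j)) -> 0 < e ->
  \forall k \near \oo, snode (smp w) k t.-1 = nd ->
    (Qv P t (x w k nd) <= Qc w k.-1 t (x w k nd) + e%:E)%E.
Proof.
move=> tT snd gapj e0; have e3 : 0 < e / 3 by rewrite divr_gt0.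
have t1 := range_ge1 tT; have [D [DP lamD]] := penalty_vanishes t1.
have gap3 : \forall k \near \oo, forall j,
    (Qv P t.+1 (x w k (rcons nd j)) <=
       Qc w k.-1 t.+1 (x w k (rcons nd j)) + (e / 3)%:E)%E.
  by apply: filter_forall => j; exact: gapj.
near=> k => sel.
have k1 : (1 <= k)%N by near: k; exists 1%N.
have lamk : lam t k * D <= e / 3 by near: k; exact: lamD.
have xin : mX P t.-1 (x w k nd) by apply: decision_in_prev snd; rewrite ?range_weak.
have trE : trial k t = x w k nd by rewrite /trial sel.
have cutle : ((cut k t (x w k nd))%:E <= Qc w k.-1 t (x w k nd) + (e / 3)%:E)%E.
  have inc : forall y, mX P t.-1 y ->
      (Qc w k t y <= Qc w k.-1 t y + (e / 3)%:E)%E.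
    by near: k; apply: Qc_increment; rewrite ?range_weak.
  by apply: le_trans (inc _ xin); rewrite Qc_rec // le_max lexx orbT.
suff : (Qv P t (x w k nd) <= (cut k t (x w k nd) + (e / 3 + e / 3))%:E)%E.
  move=> /le_trans; apply; rewrite EFinD.
  apply: le_trans (leeD2r _ cutle) _; rewrite -addeA -EFinD.
  by apply: leeD2l; rewrite lee_fin; lra.
rewrite -trE /cut subrr [dotv _ 0]big1 ?addr0 => [|i _]; last by rewrite mxE mulr0.
(* The error is spread over the children with weights summing to 1, which reduces the claim to one
   child. *)
rewrite (_ : \sum_(j < M) _ + _ = \sum_(j < M) mp P t j *
    (fine (Qlow k t j (trial k t)) + (e / 3 + e / 3))); last first.
  under [RHS]eq_bigr do rewrite mulrDr.
  by rewrite big_split /= -mulr_suml prob_sum // mul1r.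
rewrite -sumEFin {1}trE Qv_rec //; apply: lee_sum => j _; rewrite EFinM.
apply: lee_wpmul2l; first by rewrite lee_fin ltW // prob_gt0.
have fwd := forward j k1 tT snd; have [fb _] := fwd.
have gapk : (Qv P t.+1 (x w k (rcons nd j)) <=
    Qc w k.-1 t.+1 (x w k (rcons nd j)) + (e / 3)%:E)%E.
  by move: j {fwd fb}; near: k.
apply: le_trans (Qfrak_le_Fbar fb gapk) _.
rewrite addrA EFinD; apply: leeD2r; rewrite EFinD -Qlow_trial //.
apply: le_trans (Fbar_le_Qinf (lam_ge0 _ _) (prox_in k1 t1) DP fwd) _.
apply: leeD; last by rewrite lee_fin.
rewrite /Qlow trE; apply: Qinf_le_mono => y.
by apply: Qc_mono (leq_pred k); exact: range_succ.
Unshelve. all: by end_near. Qed.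

(** The thresholds [1 / (i + 1)] keep the family of events countable. A node [nd] has stage
    [size nd + 1], so its value function has index [size nd + 2]. *)
Definition bad_gap nd (i : nat) k := ~ (Qv P (size nd).+2 (x w k nd) <=
   Qc w k.-1 (size nd).+2 (x w k nd) + (i.+1%:R^-1)%:E)%E.

(** The only probabilistic input of the pathwise argument. *)
Definition bad_gaps_are_sampled := forall nd i, ((size nd).+2 <= T)%N ->
  (forall m, exists2 k, (m <= k)%N & bad_gap nd i k) ->
  forall m, exists2 k, (m <= k)%N &
    bad_gap nd i k /\ snode (smp w) k (size nd).+1 = nd.

Lemma gap_vanishes_all : bad_gaps_are_sampled ->
  forall t, (2 <= t <= T.+1)%N -> forall nd, size nd = (t - 2)%N ->
  gap_vanishes t nd.
Proof.
move=> sampled; apply: backward_ind => [nd _ e e0|t tT IH nd snd e e0].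
  by near=> k; rewrite Qv_last Qc_last add0e lee_fin ltW.
have tE : (size nd).+2 = t by rewrite snd -addn2 subnK //; case/andP: tT.
have [i ie] : exists i : nat, i.+1%:R^-1 <= e.
  have [N _ /(_ N (leqnn N)) eN] := nbhs_infty_ger e^-1.
  by exists N; rewrite invf_ple ?posrE ?ltr0n // (le_trans eN) // ler_nat.
apply: contrapT => notev.
have io m : exists2 k, (m <= k)%N & bad_gap nd i k.
  apply: contrapT => nex; apply: notev; exists m => // k /= mk.
  apply: contrapT => nle; apply: nex; exists k => //.
  rewrite /bad_gap tE => le; apply: nle; apply: le_trans le _.
  by apply: leeD2l; rewrite lee_fin.
have gapj j : gap_vanishes t.+1 (rcons nd j).
  apply: IH; rewrite size_rcons snd subSn //; case/andP: tT => //.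
have i0 : 0 < i.+1%:R^-1 :> R by rewrite invr_gt0 ltr0n.
have [N _ HN] := selected_gap tT snd gapj i0.
have tT2 : ((size nd).+2 <= T)%N by rewrite tE; case/andP: tT.
have [k Nk [bad sel]] := sampled nd i tT2 io N.
by apply: bad; rewrite tE; apply: HN => //; rewrite -sel -tE.
Unshelve. all: by end_near. Qed.

Lemma gap_cvg t nd : (2 <= t <= T.+1)%N -> size nd = (t - 2)%N ->
  gap_vanishes t nd ->
  (fun k => Qv P t (x w k nd) - Qc w k t (x w k nd))%E @ \oo --> 0%E.
Proof.
move=> tT snd gap; rewrite -[0%E]/(0%:E); apply: ereal_cvg_squeeze => e e0.
near=> k.
have k1 : (1 <= k)%N by near: k; exists 1%N.
have : (Qv P t (x w k nd) <= Qc w k t (x w k nd) + e%:E)%E.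
  apply: (@le_trans _ _ (Qc w k.-1 t (x w k nd) + e%:E)%E).
    by near: k; exact: gap.
  by apply: leeD2r; apply: Qc_mono; rewrite ?leq_pred.
have := Qc_le_Qv tT k (x w k nd); have := Qc_gtNy (x w k nd) k1 tT.
have [r ->] := Qv_real tT (decision_in_prev k1 tT snd).
case: (Qc w k t _) => [s||] // _; rewrite ?leye_eq // -EFinD -EFinB !lee_fin.
by move=> sr rse; rewrite sub0r add0r; apply/andP; split; lra.
Unshelve. all: by end_near. Qed.

(** * Convergence of the first-stage values *)

Section FirstStage.
Hypothesis T1 : (1 <= T)%N.
Hypothesis gap1 : gap_vanishes 2 [::].
Let x1 k := x w k [::].
Let Fbar1 k :=
  Fbar P 1 (mxi1 P) (Qc w k.-1 2%N) (lam 1%N k) (xP w k 1%N) (mx0 P) (x1 k).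

Let stage1 : (1 <= 1 <= T)%N. Proof. by []. Qed.
Let stage2 : (2 <= 2 <= T.+1)%N. Proof. by []. Qed.

Lemma Qinf1_le_optval k : (Qinf P 1 (Qc w k 2%N) (mx0 P) (mxi1 P) <= optval P)%E.
Proof. by apply: Qinf_le_mono => y; exact: Qc_le_Qv. Qed.

Lemma optval_real : exists v : R, optval P = v%:E.
Proof.
apply: real_between; last first.
  have [y Xy|e e0 He] := @Qinf_fin_near 1 (Qv P 2) stage1.
    by have [r ->] := Qv_real stage2 Xy; rewrite ltry.
  by apply: He supp1 _; apply: enlarge_self (ltW e0) _.
have [D [DP _]] := penalty_vanishes stage1.
(* Iteration 2 uses the model [Qc w 1 2], which is nowhere [-oo], whereas the initial minorant used
   at iteration 1 may be. *)
have fwd := @forward1 2 isT.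
have := Fbar_le_Qinf (lam_ge0 1 2) (prox_in (isT : (1 <= 2)%N) stage1) DP fwd.
have : (-oo < Fbar P 1 (mxi1 P) (Qc w 1 2%N) (lam 1%N 2) (xP w 2 1%N) (mx0 P) (x1 2))%E.
  rewrite /Fbar; have := Qc_gtNy (x1 2) (isT : (1 <= 1)%N) stage2.
  have := cost_gtNy h2 stage1 supp1 (mx0 P) (x1 2).
  by case: (mf _ _ _ _ _) => [r||] //; case: (Qc _ _ _ _) => [s||] //= _ _;
    rewrite -?EFinD ?ltNyr.
move=> /lt_le_trans /[apply]; have := Qinf1_le_optval 1.
by case: (optval P) => [r||]; rewrite ?ltNyr // leeNy_eq => /eqP ->.
Qed.

(** Both sequences are squeezed by [optval - e <= Fbar1 <= Qinf + e <= optval + e]: the left bound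
    comes from the gap at the first node, the middle one from the penalty, the right one from
    validity of the cuts. *)
Lemma first_stage_cvg :
  Fbar1 @ \oo --> optval P /\
  (fun k => Qinf P 1 (Qc w k 2%N) (mx0 P) (mxi1 P)) @ \oo --> optval P.
Proof.
have [v vE] := optval_real; have [D [DP lamD]] := penalty_vanishes stage1.
have lower e : 0 < e -> \forall k \near \oo, (v%:E <= Fbar1 k + e%:E)%E.
  move=> e0; near=> k; rewrite -vE; apply: Qfrak_le_Fbar.
    by have [|] := @forward1 k; first by near: k; exists 1%N.
  by near: k; exact: gap1.
have upper e : 0 < e -> \forall k \near \oo,
    (Fbar1 k <= Qinf P 1 (Qc w k 2%N) (mx0 P) (mxi1 P) + e%:E)%E.
  move=> e0; near=> k; have k1 : (1 <= k)%N by near: k; exists 1%N.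
  apply: le_trans (Fbar_le_Qinf (lam_ge0 _ _) (prox_in k1 stage1) DP (forward1 k1)) _.
  apply: leeD; last by rewrite lee_fin; near: k; exact: lamD.
  by apply: Qinf_le_mono => y; apply: Qc_mono => //; exact: leq_pred.
have le_v k : (Qinf P 1 (Qc w k 2%N) (mx0 P) (mxi1 P) <= v%:E)%E.
  by rewrite -vE; exact: Qinf1_le_optval.
rewrite vE; split; apply: ereal_cvg_squeeze => e e0.
  near=> k; have lo : (v%:E <= Fbar1 k + e%:E)%E by near: k; exact: lower.
  have up : (Fbar1 k <= Qinf P 1 (Qc w k 2%N) (mx0 P) (mxi1 P) + e%:E)%E.
    by near: k; exact: upper.
  rewrite EFinB leeBlDr // lo /= EFinD; apply: le_trans up _.
  by apply: leeD2r; exact: le_v.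
have e2 : 0 < e / 2 by rewrite divr_gt0.
near=> k; have lo : (v%:E <= Fbar1 k + (e / 2)%:E)%E by near: k; exact: lower.
have up : (Fbar1 k <= Qinf P 1 (Qc w k 2%N) (mx0 P) (mxi1 P) + (e / 2)%:E)%E.
  by near: k; exact: upper.
apply/andP; split; last first.
  by apply: le_trans (le_v k) _; rewrite lee_fin lerDl ltW.
rewrite EFinB leeBlDr //.
rewrite [e]splitr EFinD addeA; apply: le_trans lo _; exact: leeD2r.
Unshelve. all: by end_near. Qed.

End FirstStage.

(** * Accumulation points of parent and child decisions *)

Section Accumulation.
Variables (a b : nat -> 'cV[R]_n) (a' b' : 'cV[R]_n).
Hypothesis close : forall e, 0 < e -> forall N, exists2 k, (N <= k)%N &
  `|a k - a'| < e /\ `|b k - b'| < e.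

Lemma frequently_near (V : set ('cV[R]_n * 'cV[R]_n)) N :
  nbhs (a', b') V -> exists2 k, (N <= k)%N & V (a k, b k).
Proof.
move=> /nbhs_ballP[e /= e0 eV]; have [k Nk [ak bk]] := close e0 N.
by exists k => //; apply: eV; split; rewrite /= -ball_normE /= distrC.
Qed.

Lemma accumulation_in (X : set 'cV[R]_n) :
  compact X -> (forall k, (1 <= k)%N -> X (b k)) -> X b'.
Proof.
move=> cX Xb; apply: contrapT => nXb.
have oX : open (~` X).
  by apply: closed_openC; apply: compact_closed => //; exact: norm_hausdorff.
have /nbhs_ballP[e /= e0 eX] : nbhs b' (~` X) by apply: open_nbhs_nbhs.
have [k k1 [_ bk]] := close e0 1%N.
by apply: (eX (b k)); [rewrite -ball_normE /= distrC|exact: Xb].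
Qed.

Lemma accumulation_feas t xi : (1 <= t <= T)%N -> supp P t xi ->
  (forall k, (1 <= k)%N -> feas P t (a k) xi (b k)) -> feas P t a' xi b'.
Proof.
move=> tT sxi fk; split.
- by apply: accumulation_in (stage_compact tT) _ => k /fk[].
- move=> i; rewrite leNgt; apply/negP => g0.
  have [_ _ /(_ xi sxi i)[_ lscg] _ _] := h2 tT.
  have [V nV VP] := lscg (a', b') 0 ltac:(by rewrite lte_fin).
  have [k k1 /VP] := @frequently_near V 1%N nV.
  by rewrite lte_fin ltNge; have [_ -> _] := fk k k1.
- apply/eqP; rewrite -subr_eq0; apply/eqP/matrixP => i j; rewrite (ord1 j) [RHS]mxE.
  set r := (_ - _ : 'cV[R]_ _).
  apply/eqP; rewrite -normr_eq0 eq_le normr_ge0 andbT leNgt; apply/negP => r0.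
  (* The residual at the limit is a linear image of the two deviations; with both below [|r_i| / C]
     it would be smaller than [|r_i|] itself. *)
  pose C := n%:R * `|mA P t xi| + n%:R * `|mB P t xi| + 1.
  have C0 : 0 < C by rewrite ltr_wpDl // addr_ge0 // mulr_ge0.
  have [k k1 [ak bk]] := close (divr_gt0 r0 C0) 1%N.
  have [_ _ lin] := fk k k1.
  have rE : r = - (mA P t xi *m (b k - b') + mB P t xi *m (a k - a')).
    by rewrite /r -lin !mulmxBr addrACA -opprD opprB.
  have := ltr_pM2r C0 (`|b k - b'|) (`|r i ord0| / C); rewrite bk.
  rewrite divfK ?lt0r_neq0 // => bC.
  have := ltr_pM2r C0 (`|a k - a'|) (`|r i ord0| / C); rewrite ak.
  rewrite divfK ?lt0r_neq0 // => aC.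
  have h : `|r i ord0| / C * C = `|r i ord0| by rewrite divfK // lt0r_neq0.
  have : `|r i ord0| <= n%:R * (`|mA P t xi| * `|b k - b'|) +
      n%:R * (`|mB P t xi| * `|a k - a'|).
    rewrite [in leLHS]rE mxE normrN mxE; apply: le_trans (ler_normD _ _) _.
    by apply: lerD; exact: mulmx_entry_le.
  have A0 : 0 <= n%:R * `|mA P t xi| by rewrite mulr_ge0.
  have B0 : 0 <= n%:R * `|mB P t xi| by rewrite mulr_ge0.
  have hb : n%:R * `|mA P t xi| * `|b k - b'| <= n%:R * `|mA P t xi| * (`|r i ord0| / C).
    by rewrite ler_wpM2l // ltW.
  have ha : n%:R * `|mB P t xi| * `|a k - a'| <= n%:R * `|mB P t xi| * (`|r i ord0| / C).
    by rewrite ler_wpM2l // ltW.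
  have rC : 0 < `|r i ord0| / C by rewrite divr_gt0.
  move: h ha hb; rewrite !mulrA {1}/C !mulrDr mulr1; nra.
Qed.

(** The limit cost is compared with [Qfrak] at [a'] through one index [k] near the limit. The five
    errors [e / 5] are lower semicontinuity of the cost and of [Qv], the gap at [b k], the penalty,
    and upper semicontinuity of [Qfrak] in the parent. *)
Lemma accumulation_optimal t xi : (1 <= t <= T)%N -> supp P t xi ->
  Xs P t.-1 a' -> (forall k, (1 <= k)%N -> Xs P t.-1 (a k)) ->
  (forall k, (1 <= k)%N -> is_argmin (feas P t (a k) xi)
     (Fbar P t xi (Qc w k.-1 t.+1) (lam t k) (xP w k t) (a k)) (b k)) ->
  (forall e : R, 0 < e -> \forall k \near \oo,
     (Qv P t.+1 (b k) <= Qc w k.-1 t.+1 (b k) + e%:E)%E) ->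
  (forall e : R, 0 < e -> exists2 h, 0 < h & forall z, Xs P t.-1 z ->
     `|z - a'| < h -> (Qfrak P t z xi <= Qfrak P t a' xi + e%:E)%E) ->
  is_argmin (feas P t a' xi) (fun y => mf P t a' y xi + Qv P t.+1 y)%E b'.
Proof.
move=> tT sxi Xa' Xa amin gapb usc.
have fa' : feas P t a' xi b'.
  by apply: accumulation_feas => // k /amin[].
split=> // z fz; apply: le_trans (Qinf_le (Qv P t.+1) fz).
have tT2 : (2 <= t.+1 <= T.+1)%N by case/andP: tT => ? ?; apply/andP.
have Xb' : mX P t b' by case: fa'.
have [q qE] := Qv_real tT2 Xb'.
have [_ [_ /(_ xi sxi)[_ _ lscf]] _ [r r0 Hr] _] := h2 tT.
have [f fE] := cost_fin_of_enlarge h2 tT sxi (Hr xi sxi).1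
  (enlarge_self (ltW r0) Xa') Xb'.
apply/lee_addgt0Pr => e e0; have e5 : 0 < e / 5 by rewrite divr_gt0.
have [V nV VP] := lscf (a', b') (f - e / 5) ltac:(by rewrite /= fE lte_fin ltrBlDr ltrDl).
have [h h0 hP] := usc _ e5; have [h' h'0 h'P] := Qv_lsc tT2 Xb' e5.
have [D [DP lamD]] := penalty_vanishes tT.
have [N _ NP] := filterI (gapb _ e5) (lamD _ e5).
have nW : nbhs (a', b') [set c | [/\ V c, `|c.1 - a'| < h & `|c.2 - b'| < h']].
  have nB : nbhs (a', b') (ball (a', b') (Num.min h h')).
    by apply: nbhsx_ballx; rewrite lt_min h0.
  apply: filterS (filterI nV nB) => -[c1 c2] [Vc [/=]].
  by rewrite -!ball_normE /= !lt_min ![`|_ - c1|]distrC ![`|_ - c2|]distrC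
    => /andP[? _] /andP[_ ?].
have [k kN [Vk ak bk]] := @frequently_near _ (maxn N 1) nW.
move: kN; rewrite geq_max => /andP[Nk k1]; have [gapk lamk] := NP k Nk.
have fk : (f%:E <= mf P t (a k) (b k) xi + (e / 5)%:E)%E.
  by rewrite -leeBlDr // -EFinB ltW //; exact: VP Vk.
have Qk : (Qv P t.+1 b' <= Qc w k.-1 t.+1 (b k) + (e / 5 + e / 5)%:E)%E.
  apply: le_trans (h'P _ bk) _; rewrite EFinD addeA; exact: leeD2r.
rewrite fE; apply: le_trans (leeD fk Qk) _.
rewrite addeACA -EFinD.
have up : (mf P t (a k) (b k) xi + Qc w k.-1 t.+1 (b k) <=
    Qfrak P t a' xi + (e / 5 + e / 5)%:E)%E.
  apply: (@le_trans _ _ (Fbar P t xi (Qc w k.-1 t.+1) (lam t k) (xP w k t)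
    (a k) (b k))); first by apply: le_Fbar; exact: lam_ge0.
  apply: le_trans (Fbar_le_Qinf (lam_ge0 _ _) (prox_in k1 tT) DP (amin k k1)) _.
  rewrite EFinD addeA; apply: leeD; last by rewrite lee_fin.
  apply: le_trans (hP _ (Xa k k1) ak).
  by apply: Qinf_le_mono => y; exact: Qc_le_Qv.
apply: le_trans (leeD2r _ up) _; rewrite -addeA -EFinD; apply: leeD2l.
by rewrite lee_fin; lra.
Qed.

End Accumulation.

Lemma accumulation_policy xst : (1 <= T)%N ->
  (forall t, (2 <= t <= T.+1)%N -> forall nd, size nd = (t - 2)%N ->
     gap_vanishes t nd) ->
  accpt P (x w) xst -> optimal_policy P xst.
Proof.
move=> T1 gaps acc.
have near_st (nd1 nd2 : seq 'I_M) : (size nd1 <= T.-1)%N -> (size nd2 <= T.-1)%N ->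
  forall e, 0 < e -> forall N, exists2 k, (N <= k)%N &
  `|x w k nd1 - xst nd1| < e /\ `|x w k nd2 - xst nd2| < e.
  move=> s1 s2 e e0 N; have [k Nk ck] := acc e e0 N; exists k => //.
  by split; apply: le_lt_trans (mx_norm_le_edist _ _) _; exact: ck.
split.
  apply: (@accumulation_optimal (fun=> mx0 P) (fun k => x w k [::]) (mx0 P)) => //.
  - move=> e e0 N; have [k Nk [ck _]] := near_st [::] [::] (leq0n _) (leq0n _) e e0 N.
    by exists k => //; rewrite subrr normr0.
  - exact: supp1.
  - by move=> k; exact: forward1.
  - exact: gaps.
  (* At the first stage the parent set is the single point [x0], so any radius works. *)
  - by move=> e e0; exists 1 => // z -> _; rewrite leeDl // lee_fin ltW.
move=> t tT nd j snd.
have /andP[t2 tleT] := tT; have t11 : (1 <= t.-1)%N by case: (t) t2 => [|[|]].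
have sndT : (size nd <= T.-1)%N.
  by rewrite snd leq_subLR add2n prednK // leqW // leqW.
have srT : (size (rcons nd j) <= T.-1)%N.
  by rewrite size_rcons snd -subSn // subSS subn1 -ltnS !prednK // ltnW.
have Xk k : (1 <= k)%N -> mX P t.-1 (x w k nd).
  by move=> k1; apply: decision_in_prev snd; rewrite ?range_weak.
have Xst : mX P t.-1 (xst nd).
  apply: (accumulation_in (near_st nd nd sndT sndT)) => //.
  exact: stage_compact (prev_range (range_weak tT)).
apply: (@accumulation_optimal (fun k => x w k nd) (fun k => x w k (rcons nd j))).
- exact: near_st.
- exact: range_ge1.
- exact: suppj.
- by rewrite XsS.
- by move=> k k1; rewrite XsS //; exact: Xk.
- by move=> k k1; exact: forward.
- apply: gaps; first exact: range_succ.
  by rewrite size_rcons snd subSn.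
- move=> e e0; have [h h0 hP] := Qfrak_usc j tT Xst e0.
  by exists h => // z _; exact: hP.
Qed.

End Path.

(** * Non-anticipativity and almost sure sampling of bad gaps *)

Section Nonanticipative.
Context (R : realType) (n K M : nat) (P : msp R n K M).
Context d (Omega : measurableType d) (smp : Omega -> nat -> nat -> 'I_M).
Context (lam : nat -> nat -> R) (Q0 : nat -> 'cV[R]_n -> \bar R).
Context (xP : Omega -> nat -> nat -> 'cV[R]_n).
Context (x : Omega -> nat -> seq 'I_M -> 'cV[R]_n).
Context (pi : Omega -> nat -> nat -> 'I_M -> 'cV[R]_n).
Context (Qc : Omega -> nat -> nat -> 'cV[R]_n -> \bar R).
Hypothesis sreda : SREDA P smp lam Q0 xP x pi Qc.

Lemma decision_nonanticipative w w' k : (1 <= k)%N ->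
  agree P smp w w' k.-1 -> x w k = x w' k.
Proof. by have [_ [_ [+ _]] _ _ _] := sreda => h k1 /(h _ _ _ k1)[]. Qed.

(** Induction on [k], then backward on the stage: the update uses the previous model, the next-stage
    model of the same iteration, and a trial point fixed by the samples up to [k]. *)
Lemma Qc_nonanticipative w w' k : agree P smp w w' k ->
  forall t, (2 <= t <= (mT P).+1)%N -> Qc w k t = Qc w' k t.
Proof.
have [_ [_ [_ piE]] [Qc0 QcT] _ bwd] := sreda.
elim: k => [_|k IH ag] t.
  case/andP=> t2; rewrite leq_eqVlt => /orP[/eqP ->|tT]; first by rewrite !QcT.
  by rewrite !Qc0 ?t2.
have agk : agree P smp w w' k.
  by move=> k' i /andP[k1 kk] iT; apply: ag => //; rewrite k1 leqW.
have xE := decision_nonanticipative (ltn0Sn k) agk.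
move: t; apply: backward_ind => [|t tT IHt]; first by rewrite !QcT.
have [_ ->] := bwd w k.+1 t (ltn0Sn k) tT.
have [_ ->] := bwd w' k.+1 t (ltn0Sn k) tT.
have -> : snode (smp w) k.+1 t.-1 = snode (smp w') k.+1 t.-1.
  apply/eq_in_map => i; rewrite mem_iota => /andP[i2 it].
  apply: ag; rewrite ?leqnn // i2 /=; case/andP: tT => t2 tT.
  apply: leq_trans tT; apply: ltnW; apply: (leq_trans it).
  by case: (t) t2 => [|[|t']].
have tT1 : (2 <= t <= (mT P).+1)%N by case/andP: tT => -> /leqW.
by apply/funext => y; rewrite IHt xE (piE w w' k.+1) //= IH.
Qed.

Lemma bad_gap_determined nd i k : (1 <= k)%N -> ((size nd).+2 <= mT P)%N ->
  determined_by (hist P smp k 2) [set w | bad_gap P x Qc w nd i k].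
Proof.
move=> k1 ndT w w' e; have ag : agree P smp w w' k.-1.
  move=> k' t /andP[k'1 kk] tT; have := congr1 (fun h => h k' t) e.
  by rewrite /hist k'1 tT -(prednK k1) ltnS kk /= => -[].
have tT : (2 <= (size nd).+2 <= (mT P).+1)%N := leqW ndT.
by rewrite /bad_gap /= (decision_nonanticipative k1 ag) (Qc_nonanticipative ag tT).
Qed.

(** Pairs of a node and a threshold are countable, so the exceptional null sets are united through
    [pickle]. *)
Lemma ae_bad_gaps_are_sampled (Pr : probability Omega R) :
  H3 P smp Pr -> {ae Pr, forall w, bad_gaps_are_sampled P smp x Qc w}.
Proof.
move=> h3.
have one (c : seq 'I_M * nat) : {ae Pr, forall w, ((size c.1).+2 <= mT P)%N ->
  (forall m, exists2 k, (m <= k)%N & bad_gap P x Qc w c.1 c.2 k) ->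
  forall m, exists2 k, (m <= k)%N &
    bad_gap P x Qc w c.1 c.2 k /\ snode (smp w) k (size c.1).+1 = c.1}.
  have [cT|cT] := leqP (size c.1).+2 (mT P); last by apply: nearW.
  have := @ae_infinitely_often_selected_node _ _ _ _ P _ _ Pr smp
    (fun k => [set w | bad_gap P x Qc w c.1 c.2 k]) c.1 h3 (ltnW cT)
    (fun k k1 => bad_gap_determined k1 cT).
  by apply: filterS => w H _.
have : {ae Pr, forall w (m : nat), if unpickle m is Some c then
   ((size c.1).+2 <= mT P)%N ->
  (forall m, exists2 k, (m <= k)%N & bad_gap P x Qc w c.1 c.2 k) ->
  forall m, exists2 k, (m <= k)%N &
    bad_gap P x Qc w c.1 c.2 k /\ snode (smp w) k (size c.1).+1 = c.1 else True}.
  by apply: ae_foralln => m; case: unpickle => [c|]; [exact: one|exact: nearW].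
apply: filterS => w H nd i; have := H (pickle (nd, i)); rewrite pickleK; exact.
Qed.

End Nonanticipative.

Unset Implicit Arguments.
Set Strict Implicit.

Theorem mainTheorem5 (R : realType) (n K M : nat) (P : msp R n K M)
  (d : measure_display) (Omega : measurableType d) (Pr : probability Omega R)
  (smp : Omega -> nat -> nat -> 'I_M)
  (lam : nat -> nat -> R) (Q0 : nat -> 'cV[R]_n -> \bar R)
  (xP : Omega -> nat -> nat -> 'cV[R]_n) (x : Omega -> nat -> seq 'I_M -> 'cV[R]_n)
  (pi : Omega -> nat -> nat -> 'I_M -> 'cV[R]_n)
  (Qc : Omega -> nat -> nat -> 'cV[R]_n -> \bar R) :
  (1 <= mT P)%N ->
  H1 P -> H2 P -> H3 P smp Pr ->
  SREDA P smp lam Q0 xP x pi Qc ->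
  (forall k, lam (mT P) k = 0) ->
  (forall t, (1 <= t <= (mT P).-1)%N -> lam t @ \oo --> 0) ->
  {ae Pr, forall w, forall t, (2 <= t <= (mT P).+1)%N ->
     forall nd : seq 'I_M, size nd = (t - 2)%N ->
     (fun k => Qv P t (x w k nd) - Qc w k t (x w k nd))%E @ \oo --> 0%E}
  /\
  {ae Pr, forall w,
     [/\ (fun k => Fbar P 1 (mxi1 P) (Qc w k.-1 2%N) (lam 1%N k) (xP w k 1%N)
                     (mx0 P) (x w k [::])) @ \oo --> optval P,
         (fun k => Qinf P 1 (Qc w k 2%N) (mx0 P) (mxi1 P)) @ \oo --> optval P
       & forall xst : seq 'I_M -> 'cV[R]_n,
           accpt P (x w) xst -> optimal_policy P xst]}.
Proof.
move=> T1 h1 h2 h3 sreda lamT lamt.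
have lam_cvg t : (1 <= t <= mT P)%N -> lam t @ \oo --> 0.
  move=> /andP[t1]; rewrite leq_eqVlt => /orP[/eqP ->|tT].
    by rewrite (_ : lam (mT P) = fun=> 0); [exact: cvg_cst|apply/funext].
  by apply: lamt; rewrite t1 -ltnS prednK.
have sampled := ae_bad_gaps_are_sampled sreda h3.
have gaps w : bad_gaps_are_sampled P smp x Qc w ->
    forall t, (2 <= t <= (mT P).+1)%N -> forall nd, size nd = (t - 2)%N ->
    gap_vanishes P x Qc w t nd.
  exact: (gap_vanishes_all h1 h2 sreda lam_cvg).
split; apply: filterS sampled => w /gaps gap.
  by move=> t tT nd snd; exact: (gap_cvg h1 h2 sreda tT snd (gap _ tT _ snd)).
have [c1 c2] := first_stage_cvg h1 h2 sreda lam_cvg T1 (gap 2%N T1 [::] erefl).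
by split => // xst; exact: (accumulation_policy h1 h2 sreda lam_cvg T1 gap).
Qed.
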